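(* Let $q \geq 3$ be a prime power and $k \geq 5$. Let $Y$ be an independent set of $qK_{2k:k}$ (i.e. a family of $k$-dimensional subspaces of $\mathbb{F}_q^{2k}$ any two of which intersect nontrivially). If $Y$ is not contained in a dictator or in the dual of a dictator, then \[ |Y| < (1 + 3q^{-1}) \begin{bmatrix} k \\ 1 \end{bmatrix} \begin{bmatrix} 2k-2 \\ k-2 \end{bmatrix}. \]
   Context: The $q$-Kneser graph $qK_{2k:k}$ has as vertices the $k$-dimensional subspaces of $\mathbb{F}_q^{2k}$, adjacent iff they intersect trivially. The Gaussian binomial coefficient is $\begin{bmatrix} n \\ m \end{bmatrix} = \prod_{i=1}^m \frac{q^{n-i+1}-1}{q^i-1}$, the number of $m$-dimensional subspaces of $\mathbb{F}_q^n$. A dictator is the set of all $k$-subspaces containing a fixed $1$-dimensional subspace (point); the dual of a dictator is the set of all $k$-subspaces contained in a fixed $(2k-1)$-dimensional subspace (hyperplane). *)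

(* Defs.v *)
From HB Require Import structures.
From mathcomp Require Import all_boot all_order all_algebra.

Set Implicit Arguments.
Unset Strict Implicit.
Unset Printing Implicit Defensive.

Import Order.TTheory GRing.Theory Num.Theory.
Local Open Scope ring_scope.

(* The library only makes {vspace vT} a choiceType; over a finite field it is
   a subtype of a finite matrix type. *)
Import VectorInternalTheory.
HB.instance Definition _ (F : finFieldType) (vT : vectType F) :=
  [Countable of {vspace vT} by <:].
HB.instance Definition _ (F : finFieldType) (vT : vectType F) :=
  [Finite of {vspace vT} by <:].

(* The truncated subtraction n.+1 - i is the exponent n - i + 1; it is exact
   whenever i <= n + 1, and the factor i = n + 1 vanishes, so that the
   coefficient is 0 for m > n. *)
Definition gauss_binom (q n m : nat) : rat :=
  \prod_(1 <= i < m.+1) ((q%:R ^+ (n.+1 - i) - 1) / (q%:R ^+ i - 1)).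

Definition qkneser_vertex (F : finFieldType) (k : nat) : finType :=
  {U : {vspace 'rV[F]_(2 * k)} | \dim U == k}.

Definition qkneser_adj (F : finFieldType) (k : nat) : rel (qkneser_vertex F k) :=
  fun U V => (val U :&: val V == 0)%VS.

Definition independent (T : finType) (e : rel T) (Y : {set T}) : Prop :=
  {in Y &, forall x y, ~~ e x y}.

Definition dictator (F : finFieldType) (k : nat)
    (P : {vspace 'rV[F]_(2 * k)}) : {set qkneser_vertex F k} :=
  [set U | (P <= val U)%VS].

Definition dual_dictator (F : finFieldType) (k : nat)
    (H : {vspace 'rV[F]_(2 * k)}) : {set qkneser_vertex F k} :=
  [set U | (val U <= H)%VS].

(* Main.v *)
Require Import Defs.
From HB Require Import structures.
From mathcomp Require Import all_boot all_order all_algebra.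
From mathcomp Require Import finfield ring lra zify.

Set Implicit Arguments.
Unset Strict Implicit.
Unset Printing Implicit Defensive.

Import Order.TTheory GRing.Theory Num.Theory.
Local Open Scope ring_scope.

(** Write [n] for the number of [k]-spaces through a line, [N = [k] n] with
    [[k] = (q^k - 1) / (q - 1)], and [D_p] for the number of members of [Y]
    through a point [p].

    Let [p] be a point missed by some member of [Y]; then [D_p <= N]. The
    members of [Y] through [p] and those missing [p] cross-intersect, and
    comparing, over the points [r <> p], the variances of the numbers of
    members of either kind through [r] shows that the product of the sizes of
    the two families is of order [q^(3-k) N^2]. If [|Y| >= (1 + 3/q) N], this
    forces [D_p] to be small, and dually the number of members of [Y] in any
    hyperplane is small.

    On the other hand put [w_p = D_p - avg D] and [w(U) = sum of w_p over the
    points p of U]. As any two members of [Y] share a point, the average of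
    [w(U)] over [Y] is at least [(q-2)/(q-1) |Y|], which bounds the sum of
    [w(U)^4] over all [k]-spaces from below. Expanding the fourth power, the
    number of [k]-spaces above four points depends only on the dimension of
    their span, and as a function of that dimension it is a combination of the
    numbers of hyperplanes, lines and points above the span. Hence the fourth
    moment is controlled by the fourth powers of the point weights, of the
    hyperplane weights, and by a Gaussian-type term from the lines; all three
    are too small. *)

(** * Inequalities between power sums *)

Section PowerSums.
Variables (R : realFieldType) (I : finType).
Implicit Types (P : pred I) (x : I -> R).

(** Cauchy-Schwarz, by expanding the nonnegative sum of all [(x i - x j) ^+ 2]. *)
Lemma sqr_sum_le P x :
  (\sum_(i | P i) x i) ^+ 2 <= #|P|%:R * \sum_(i | P i) x i ^+ 2.
Proof.
have : 0 <= \sum_(i | P i) \sum_(j | P j) (x i - x j) ^+ 2.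
  by apply: sumr_ge0 => i _; apply: sumr_ge0 => j _; apply: sqr_ge0.
have -> : \sum_(i | P i) \sum_(j | P j) (x i - x j) ^+ 2 =
  2 * (#|P|%:R * \sum_(i | P i) x i ^+ 2 - (\sum_(i | P i) x i) ^+ 2).
  transitivity (\sum_(i | P i) (#|P|%:R * x i ^+ 2
     - 2 * x i * (\sum_(j | P j) x j) + \sum_(j | P j) x j ^+ 2)).
    apply: eq_bigr => i _; rewrite mulr_sumr mulr_natl -sumr_const.
    rewrite -sumrB -big_split /=.
    by apply: eq_bigr => j _; ring.
  rewrite big_split sumrB /= -mulr_suml -mulr_sumr -mulr_sumr sumr_const.
  rewrite -mulr_natl; ring.
lra.
Qed.

Lemma pow4_sum_le P x :
  (\sum_(i | P i) x i) ^+ 4 <= #|P|%:R ^+ 3 * \sum_(i | P i) x i ^+ 4.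
Proof.
have h1 := sqr_sum_le P x; have h2 := sqr_sum_le P (fun i => x i ^+ 2).
have E4 : \sum_(i | P i) (x i ^+ 2) ^+ 2 = \sum_(i | P i) x i ^+ 4.
  by apply: eq_bigr => i _; rewrite -exprM.
rewrite {}E4 in h2.
set S := \sum_(i | P i) x i in h1 *.
set S2 := \sum_(i | P i) x i ^+ 2 in h1 h2.
set S4 := \sum_(i | P i) x i ^+ 4 in h2 *.
have N0 : 0 <= #|P|%:R :> R by [].
have : (S ^+ 2) ^+ 2 <= (#|P|%:R * S2) ^+ 2
  by rewrite lerXn2r ?nnegrE ?sqr_ge0 // (le_trans _ h1) ?sqr_ge0.
rewrite -exprM => h3; apply: (le_trans h3); rewrite exprMn.
by rewrite [_ ^+ 3]exprSr -mulrA ler_wpM2l ?exprn_ge0.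
Qed.

(* Expanding the fourth power of a sum, the terms [x_i^4] and [x_i^3 x_j] are
   exactly those cancelled on the left; all the others are dominated by the
   products [x_i^2 x_j^2] with [i != j]. *)
Lemma power_sum4_le P x (m := #|P|%:R : R)
    (p := fun e => \sum_(i | P i) x i ^+ e) :
  p 1 ^+ 4 - 4 * (p 3 * p 1) + 3 * p 4
    <= (m ^+ 2 + m - 3) * (p 2 ^+ 2 - p 4).
Proof.
have pM e y : p e * y = \sum_(i | P i) x i ^+ e * y by exact: mulr_suml.
(* The factor [p 1 - x i] is the sum of the [x j] with [j != i]. Cauchy-Schwarz over these [j] gives
   [leZ], and Cauchy-Schwarz over [i] gives [le2]. *)
pose Z := \sum_(i | P i) (x i * (p 1 - x i)) ^+ 2.
have ZE : Z = p 2 * p 1 ^+ 2 - 2 * p 3 * p 1 + p 4.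
  rewrite -mulrA !pM mulr_sumr -sumrB -big_split /=.
  by apply: eq_bigr => i _; ring.
have leZ : Z <= (m - 1) * (p 2 ^+ 2 - p 4).
  have -> : (m - 1) * (p 2 ^+ 2 - p 4) =
    \sum_(i | P i) x i ^+ 2 * ((m - 1) * (p 2 - x i ^+ 2)).
    rewrite expr2 pM [p 4]/p -sumrB mulr_sumr.
    by apply: eq_bigr => i _; ring.
  apply: ler_sum => i Pi; rewrite exprMn ler_wpM2l ?sqr_ge0 //.
  have := sqr_sum_le (fun j => P j && (j != i)) x.
  have -> : #|fun j => P j && (j != i)|%:R = m - 1 :> R.
    rewrite /m (cardD1 i) [i \in _]Pi natrD addrAC subrr add0r; congr (_%:R).
    by apply: eq_card => j; rewrite !inE andbC.
  have -> : \sum_(j | P j && (j != i)) x j = p 1 - x i.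
    by rewrite /p [in RHS](bigD1 i) //= addrAC subrr add0r.
  have -> // : \sum_(j | P j && (j != i)) x j ^+ 2 = p 2 - x i ^+ 2.
  by rewrite /p [in RHS](bigD1 i) //= addrAC subrr add0r.
have le2 : (p 1 ^+ 2 - p 2) ^+ 2 <= m * Z.
  have := sqr_sum_le P (fun i => x i * (p 1 - x i)).
  have -> // : \sum_(i | P i) x i * (p 1 - x i) = p 1 ^+ 2 - p 2.
  rewrite expr2 pM [p 2]/p -sumrB.
  by apply: eq_bigr => i _; ring.
have := ler_wpM2l (ler0n R #|P|) leZ; rewrite -/m => leZ'.
have -> : p 1 ^+ 4 - 4 * (p 3 * p 1) + 3 * p 4 =
  (p 1 ^+ 2 - p 2) ^+ 2 + 2 * Z - (p 2 ^+ 2 - p 4) by rewrite ZE; ring.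
have -> : (m ^+ 2 + m - 3) * (p 2 ^+ 2 - p 4) =
  m * ((m - 1) * (p 2 ^+ 2 - p 4)) + 2 * ((m - 1) * (p 2 ^+ 2 - p 4))
  - (p 2 ^+ 2 - p 4) by ring.
lra.
Qed.
End PowerSums.

(** * Double counting in incidence structures and 2-designs *)

Section Designs.
Variables (R : realFieldType) (I J : finType) (r : I -> J -> bool).
Variables (A : pred I) (B : pred J).
Implicit Types f g : J -> R.

Lemma incidence_exchange f :
  \sum_(i | A i) \sum_(j | B j && r i j) f j =
  \sum_(j | B j) #|[pred i | A i && r i j]|%:R * f j.
Proof.
rewrite (exchange_big_dep B) /= => [|i j _ /andP[]//].
apply: eq_bigr => j Bj; rewrite sumr_const mulr_natl; congr (_ *+ _).
by apply: eq_card => i; rewrite !inE -topredE /= Bj.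
Qed.

Lemma incidence_bilinear f g :
  \sum_(i | A i) (\sum_(j | B j && r i j) f j) * (\sum_(j | B j && r i j) g j)
  = \sum_(j | B j) \sum_(j' | B j')
      #|[pred i | A i && (r i j && r i j')]|%:R * (f j * g j').
Proof.
under eq_bigr => i _.
  rewrite mulr_suml; under eq_bigr => j _ do rewrite mulr_sumr; over.
rewrite (exchange_big_dep B) /= => [|i j _ /andP[]//].
apply: eq_bigr => j Bj.
rewrite (exchange_big_dep B) /= => [|i j' _ /andP[]//].
apply: eq_bigr => j' Bj'; rewrite sumr_const mulr_natl; congr (_ *+ _).
by apply: eq_card => i; rewrite !inE -topredE /= Bj Bj' /= andbA.
Qed.

(** Off the diagonal each product [f j * g j'] is counted [e2] times, on the diagonal [e1] times.
    For [f] with sum zero only the last term survives, which evaluates second moments exactly. *)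
Lemma design_bilinear (e1 e2 : R) f g :
  {in B, forall j, #|[pred i | A i && r i j]|%:R = e1} ->
  {in B &, forall j j', j != j' ->
    #|[pred i | A i && (r i j && r i j')]|%:R = e2} ->
  \sum_(i | A i) (\sum_(j | B j && r i j) f j) * (\sum_(j | B j && r i j) g j)
  = e2 * (\sum_(j | B j) f j) * (\sum_(j | B j) g j)
    + (e1 - e2) * \sum_(j | B j) f j * g j.
Proof.
move=> H1 H2; rewrite incidence_bilinear.
rewrite -mulrA mulr_suml !mulr_sumr -big_split /=; apply: eq_bigr => j Bj.
rewrite (bigD1 j) //= mulr_sumr [in RHS]mulr_sumr [in RHS](bigD1 j) //=.
have -> : #|[pred i | A i && (r i j && r i j)]|%:R = e1.
  by rewrite -(H1 _ Bj); congr (_%:R); apply: eq_card => i; rewrite !inE andbb.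
rewrite (eq_bigr (fun j' => e2 * (f j * g j'))); last first.
  by move=> j' /andP[Bj' ne]; rewrite H2 // eq_sym.
ring.
Qed.

End Designs.

(** * Points and dimensions of subspaces *)

Section Subspaces.
Variables (F : finFieldType) (n : nat).
Local Notation V := 'rV[F]_n.
Implicit Types (U W J p r : {vspace V}).

Definition point p := \dim p == 1%N.

Lemma dimrv : \dim {: V} = n.
Proof. by rewrite dimvf /dim /= mul1n. Qed.

Lemma dim_le_n U : (\dim U <= n)%N.
Proof. by have := dimvS (subvf U); rewrite dimrv. Qed.

Lemma point_cap p U : point p -> (p <= U)%VS = ((p :&: U)%VS != 0%VS).
Proof.
move/eqP=> dp; apply/idP/idP => [/capv_idPl -> | ].
  by rewrite -dimv_eq0 dp.
rewrite -dimv_eq0 -lt0n => h; apply/capv_idPl/eqP.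
by rewrite eqEdim capvSl dp.
Qed.

Lemma dim_add_point p U : point p -> ~~ (p <= U)%VS -> \dim (U + p)
  = (\dim U).+1.
Proof.
move=> pp; rewrite (point_cap _ pp) negbK => /eqP cap0.
by rewrite dimv_disjoint_sum ?(eqP pp) ?addn1 // capvC.
Qed.

Lemma dim_add2 p r : point p -> point r -> p != r -> \dim (p + r) = 2.
Proof.
move=> pp pr ne; rewrite dim_add_point ?(eqP pp) //.
by apply: contra ne => le; rewrite eq_sym eqEdim le (eqP pp) (eqP pr).
Qed.

Lemma sub_point p r : point p -> point r -> (p <= r)%VS = (p == r).
Proof. by move=> /eqP dp /eqP dr; rewrite eqEdim dp dr andbT. Qed.

Lemma point_line (v : V) : v != 0 -> point <[v]>%VS.
Proof. by move=> nz; rewrite /point dim_vline nz. Qed.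

Lemma ex_point U : U != 0%VS -> exists2 p, point p & (p <= U)%VS.
Proof.
move=> nz; exists <[vpick U]>%VS; first by apply: point_line; rewrite vpick0.
by rewrite -memvE memv_pick.
Qed.

Lemma card_nonzero U : (#|[pred v : V | (v \in U) && (v != 0)]|).+1
  = (#|F| ^ \dim U)%N.
Proof.
rewrite -(card_vspace (U : {vspace V})) [RHS](cardD1 0) mem0v add1n.
by congr _.+1; apply: eq_card => v; rewrite !inE andbC.
Qed.

(** Each nonzero vector of [U] spans one point of [U], and each point arises from [#|F|.-1]
    vectors. *)
Lemma card_points_mul U :
  (#|[pred p | point p && (p <= U)%VS]| * (#|F|.-1) = (#|F| ^ \dim U).-1)%N.
Proof.
rewrite -card_nonzero /= -sum_nat_const -[RHS]sum1_card.
rewrite [RHS](partition_big (fun v : V => <[v]>%VS) [pred p | point p && (p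
  <= U)%VS]) /=.
  apply: eq_bigr => p /andP[pp pU]; rewrite sum1_card.
  transitivity #|[pred v : V | (v \in p) && (v != 0)]|.
    by apply: succn_inj; rewrite card_nonzero (eqP pp) expn1 prednK //
      (cardD1 0).
  apply: eq_card => v; rewrite !inE -topredE /=.
  rewrite [v \in [pred _ in U | _]]inE /=.
  case: (eqVneq v 0) => [->|nz]; first by rewrite !andbF.
  rewrite !andbT; apply/idP/idP => [vp | /andP[_ /eqP <-]];
    last exact: memv_line.
  rewrite (subvP pU) //= -sub_point ?point_line //; by rewrite -memvE.
by move=> v; rewrite inE => /andP[vU nz]; rewrite point_line //= -memvE.
Qed.

End Subspaces.

(** * Numbers of subspaces above a given one *)

Section Counting.
Variables (F : finFieldType) (n : nat).
Local Notation V := 'rV[F]_n.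
Local Notation q := (#|F|%:R : rat).
Implicit Types (U W J p r : {vspace V}).

Lemma q_gt1 : 1 < q.
Proof. by rewrite ltr1n finNzRing_gt1. Qed.

Lemma q_gt0 : 0 < q. Proof. exact: lt_trans q_gt1. Qed.

Definition qnum (d : nat) : rat := (q ^+ d - 1) / (q - 1).

Lemma card_points U : #|[pred p | point p && (p <= U)%VS]|%:R = qnum (\dim U).
Proof.
have nz : q - 1 != 0 by rewrite subr_eq0 gt_eqF ?q_gt1.
apply: (canRL (mulfK nz)); have := card_points_mul U.
have F0 : (0 < #|F|)%N by rewrite ltnW ?finNzRing_gt1.
move/(congr1 (fun m => m%:R : rat));
  rewrite natrM -!subn1 !natrB ?expn_gt0 ?F0 //.
by rewrite natrX.
Qed.

(* The number of [d]-spaces above a fixed [j]-space, for [j <= d]; the empty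
   product makes it 1, not 0, for [j > d]. *)
Definition nabove (d j : nat) : rat :=
  \prod_(j <= i < d) ((q ^+ n - q ^+ i) / (q ^+ d - q ^+ i)).

Lemma qX_lt i j : (i < j)%N -> q ^+ i < q ^+ j.
Proof. by move=> ij; rewrite ltr_eXn2l ?q_gt1. Qed.

Lemma qX_le i j : (i <= j)%N -> q ^+ i <= q ^+ j.
Proof. by move=> ij; rewrite ler_eXn2l ?q_gt1. Qed.

(** Induction on [d - \dim J]: count the pairs of a [d]-space [U] above [J] and a point [p] of [U]
    outside [J] in two ways, the induction hypothesis applying to [J + p]. *)
Lemma card_above (d : nat) J : (\dim J <= d)%N ->
  #|[pred U | (\dim U == d) && (J <= U)%VS]|%:R = nabove d (\dim J).
Proof.
move Em : (d - \dim J)%N => m; elim: m J Em => [|m IH] J Em le.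
  have <- : \dim J = d by apply/eqP; rewrite eqn_leq le -subn_eq0 Em /=.
  rewrite /nabove big_geq //; transitivity (#|pred1 J|%:R : rat);
    last by rewrite card1.
  congr (_%:R); apply: eq_card => U; rewrite !inE andbC.
  by rewrite [U == J]eq_sym eqEdim; case: (J <= U)%VS / boolP => //= /dimvS h;
    rewrite eqn_leq h andbT.
have lt : (\dim J < d)%N by rewrite -subn_gt0 Em.
have nz : q ^+ d - q ^+ \dim J != 0 by rewrite subr_eq0 gt_eqF // qX_lt.
have q1 : q - 1 != 0 by rewrite subr_eq0 gt_eqF ?q_gt1.
have out U : (J <= U)%VS ->
    #|[pred p | (point p && ~~ (p <= J)%VS) && (p <= U)%VS]|%:R
    = (q ^+ \dim U - q ^+ \dim J) / (q - 1).
  move=> JU; have -> : (q ^+ \dim U - q ^+ \dim J) / (q - 1)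
    = qnum (\dim U) - qnum (\dim J) by rewrite /qnum; field.
  rewrite -!card_points; apply/esym/(canLR (addrK _)); rewrite -natrD addnC.
  congr (_%:R); rewrite -(cardID [pred p | (p
    <= J)%VS] [pred p | point p && (p <= U)%VS]).
  congr (_ + _)%N; apply: eq_card => p; rewrite !inE.
    by case: (p <= J)%VS / boolP => [pJ|];
      rewrite ?andbF // (subv_trans pJ JU) !andbT.
  by case: (p <= J)%VS; rewrite ?andbF ?andbT.
have := @incidence_exchange rat _ _ (fun U p => (p <= U)%VS)
  [pred U | (\dim U == d) && (J <= U)%VS] [pred p | point p && ~~ (p
    <= J)%VS] (fun=> 1).
under eq_bigr => U /andP[/eqP dU JU].
  rewrite sumr_const out // dU; over.
rewrite sumr_const.
under [RHS]eq_bigr => p /andP[pp pJ].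
  rewrite mulr1 (_ : #|_|%:R = nabove d (\dim J).+1); last first.
    rewrite -(dim_add_point pp pJ) -IH ?dim_add_point //;
      last by rewrite subnS Em.
    by congr (_%:R); apply: eq_card => U; rewrite !inE subv_add andbA.
  over.
rewrite sumr_const => E; move: E; rewrite -[LHS]mulr_natl -[RHS]mulr_natl.
have -> : #|[pred p | point p && ~~ (p <= J)%VS]|%:R
  = (q ^+ n - q ^+ \dim J) / (q - 1).
  have := out _ (subvf J); rewrite dimrv => <-; congr (_%:R).
  by apply: eq_card => p; rewrite !inE subvf andbT.
move=> E; rewrite /nabove big_ltn // -/(nabove d (\dim J).+1).
apply: (mulIf nz); apply: (mulIf (invr_neq0 q1)).
by rewrite -mulrA E; field; rewrite q1.
Qed.

Lemma naboveS d j : (j < d)%N ->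
  nabove d j * (q ^+ d - q ^+ j) = (q ^+ n - q ^+ j) * nabove d j.+1.
Proof.
move=> lt; rewrite /nabove big_ltn //.
have nz : q ^+ d - q ^+ j != 0 by rewrite subr_eq0 gt_eqF // qX_lt.
by field.
Qed.

Lemma nabove_gt0 d j : (d <= n)%N -> 0 < nabove d j.
Proof.
move=> dn; rewrite /nabove big_nat; apply: prodr_gt0 => i /andP[_ id].
by rewrite divr_gt0 // subr_gt0 qX_lt // (leq_trans id).
Qed.

End Counting.

(** * Orthogonal complements *)

Section Perp.
Variables (F : finFieldType) (n : nat).
Local Notation V := 'rV[F]_n.
Implicit Types (U W : {vspace V}).

Definition basis_mx U : 'M[F]_(\dim U, n) := \matrix_i (vbasis U)`_i.

(** The orthogonal complement for the standard dot product. It may meet [U] nontrivially; what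
    matters is that it is an inclusion-reversing involution exchanging points and hyperplanes. *)
Definition perp U : {vspace V} := lker (linfun (mulmxr (basis_mx U)^T)).

Lemma perpP U (v : V) : reflect {in U, forall u, v *m u^T = 0} (v \in perp U).
Proof.
rewrite memv_ker lfunE /=; apply: (iffP eqP) => [v0 u uU | v0].
  have trZ a (x : V) : (a *: x)^T = a *: x^T by apply/matrixP => b c;
    rewrite !mxE.
  rewrite (coord_vbasis uU) raddf_sum mulmx_sumr big1 // => i _.
  rewrite /= trZ -scalemxAr; apply/eqP; rewrite scaler_eq0; apply/orP; right.
  apply/eqP/matrixP => a b; have := congr1 (fun M : 'M_(_, _) => M 0 i) v0.
  rewrite !mxE => e; rewrite ord1 -[RHS]e.
  by apply: eq_bigr => j _; rewrite !mxE ord1.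
apply/rowP => i; rewrite mxE [RHS]mxE.
have iU : (vbasis U)`_i \in U by rewrite vbasis_mem // mem_nth // size_tuple.
have := congr1 (fun M : 'M_(_, _) => M 0 0) (v0 _ iU); rewrite !mxE => e.
by rewrite -[RHS]e; apply: eq_bigr => j _; rewrite !mxE.
Qed.

Lemma perp_anti U W : (U <= W)%VS -> (perp W <= perp U)%VS.
Proof.
by move=> /subvP UW; apply/subvP => v /perpP vW; apply/perpP => u /UW;
  apply: vW.
Qed.

Lemma sub_perp_perp U : (U <= perp (perp U))%VS.
Proof.
apply/subvP => u uU; apply/perpP => v /perpP /(_ _ uU) e.
by rewrite -[LHS]trmxK trmx_mul trmxK e trmx0.
Qed.

(** Rank-nullity: the rows of [basis_mx U] are independent, so the map defining [perp U] is onto. *)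
Lemma dim_perp U : \dim (perp U) = (n - \dim U)%N.
Proof.
have rf : row_free (basis_mx U).
  apply: inj_row_free => w; rewrite mulmx_sum_row => w0; apply/rowP => i.
  rewrite mxE; move/freeP: (basis_free (vbasisP U)); apply.
  by rewrite -[RHS]w0; apply: eq_bigr => j _; rewrite rowK.
have full : row_full (basis_mx U)^T by rewrite /row_full mxrank_tr.
have im : limg (linfun (mulmxr (basis_mx U)^T) : 'Hom('rV[F]_n, 'rV[F]_(\dim
  U))) = fullv.
  apply/vspaceP => w; rewrite memvf; have [C CB] := row_fullP full.
  apply/memv_imgP; exists (w *m C); first exact: memvf.
  by rewrite lfunE /= -mulmxA CB mulmx1.
have := limg_ker_dim (linfun (mulmxr (basis_mx U)^T) : 'Hom('rV[F]_n,
  'rV[F]_(\dim U))) fullv.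
by rewrite im !dimrv capfv => /(canRL (addnK _)).
Qed.

Lemma perpK : involutive perp.
Proof.
move=> U; apply/eqP; rewrite eq_sym eqEdim sub_perp_perp !dim_perp.
by rewrite subKn /= ?leqnn ?dim_le_n.
Qed.

Lemma sub_perp U W : (perp U <= perp W)%VS = (W <= U)%VS.
Proof.
apply/idP/idP => [/perp_anti|]; last exact: perp_anti.
by rewrite !perpK.
Qed.

End Perp.

(** * Degrees of points in an intersecting family *)

Section PointDegrees.
Variables (F : finFieldType) (k : nat).
Hypothesis k_gt4 : (4 < k)%N.
Local Notation V := 'rV[F]_(2 * k).
Local Notation q := (#|F|%:R : rat).
Local Notation nk := (nabove F (2 * k) k).
Local Notation qn := (qnum F).
Implicit Types (U W S J p r s : {vspace V}) (Y : {set {vspace V}}).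

Definition intersecting Y :=
  {in Y, forall U, \dim U = k} /\ {in Y &, forall U W, (U :&: W != 0)%VS}.

Definition degree Y p : rat := #|[pred U | (U \in Y) && (p <= U)%VS]|%:R.

Lemma nk_ge0 j : 0 <= nk j.
Proof. by rewrite ltW // nabove_gt0 //; lia. Qed.

(** By [naboveS] the quotient is [(q^(2k) - q^j) / (q^k - q^j)], which is at least [q^k]. *)
Lemma nk_ratio j : (j < k)%N -> q ^+ k * nk j.+1 <= nk j.
Proof.
move=> jk; have h : 0 < q ^+ k - q ^+ j by rewrite subr_gt0 qX_lt.
rewrite -(ler_pM2r h) naboveS // mulrAC ler_wpM2r ?nk_ge0 //.
rewrite mul2n -addnn exprD mulrBr lerD2l lerN2.
by rewrite ler_peMl ?exprn_ege1 ?exprn_ge0 ?ltW ?q_gt1 // q_gt0.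
Qed.

Lemma nk_le j : (j < k)%N -> nk j.+1 <= nk j.
Proof.
move=> jk; apply: le_trans (nk_ratio jk).
by rewrite ler_peMl ?nk_ge0 // exprn_ege1 // ltW ?q_gt1.
Qed.

Lemma card_nk J j : \dim J = j -> (j <= k)%N ->
  #|[pred U | (\dim U == k) && (J <= U)%VS]|%:R = nk j.
Proof. by move=> <-; apply: card_above. Qed.

(** A member through [p] meets [S] in some point [r], and [r != p] since [S] misses [p]; so it lies
    above a line [p + r]. There are [qn k] choices of [r], with [nk 2] [k]-spaces above each
    line. *)
Lemma degree_le Y p : intersecting Y -> point p ->
  (exists2 S, S \in Y & ~~ (p <= S)%VS) -> degree Y p <= qn k * nk 2.
Proof.
move=> [dY iY] pp [S SY pS].
have := @incidence_exchange rat _ _ (fun U r => (r <= U)%VS)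
  [pred U | (\dim U == k) && (p <= U)%VS] [pred r | point r && (r <= S)%VS]
  (fun=> 1).
have -> : \sum_(r in [pred r | point r && (r <= S)%VS])
  #|[pred U | [pred U | (\dim U == k) & (p <= U)%VS] U & (r <= U)%VS]|%:R * 1
  = qn k * nk 2.
  rewrite (eq_bigr (fun=> nk 2)).
    by rewrite sumr_const -mulr_natl card_points dY.
  move=> r /andP[pr rS]; rewrite mulr1.
  have d2 : \dim (p + r) = 2%N.
    by rewrite dim_add2 //; apply: contraNneq pS => ->.
  rewrite -(card_nk d2); last by lia.
  by congr (_%:R); apply: eq_card => U; rewrite !inE subv_add andbA.
move=> <-.
rewrite /degree -sum1_card natr_sum.
rewrite [leRHS](bigID [pred U | U \in Y]) /= -[leLHS]addr0; apply: lerD;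
  last first.
  by apply: sumr_ge0 => U _; apply: sumr_ge0.
rewrite [leRHS](eq_bigl [pred U | (U \in Y) && (p <= U)%VS]); last first.
  move=> U; rewrite /= andbC; case UY: (U \in Y) => //=.
  by rewrite (dY _ UY) eqxx.
apply: ler_sum => U /andP[UY pU].
have [r pr] := ex_point (iY _ _ UY SY); rewrite subv_cap => /andP[rU rS].
by rewrite (bigD1 r) /= ?pr ?rU ?rS // lerDl sumr_ge0.
Qed.

Lemma qsub1_gt0 : 0 < q - 1.
Proof. by rewrite subr_gt0 q_gt1. Qed.

Lemma card_other_points p U : point p ->
  #|[pred r | (point r && (r != p)) && (r <= U)%VS]|%:R
  = qn (\dim U) - (p <= U)%VS%:R.
Proof.
move=> pp; rewrite -card_points [in RHS](cardD1 p) inE /= pp natrD addrAC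
  subrr add0r.
by congr (_%:R); apply: eq_card => r; rewrite !inE andbAC andbC.
Qed.

Lemma pairs_nk p r : point p -> point r -> p != r ->
  #|[pred U | (\dim U == k) && ((p <= U) && (r <= U))%VS]|%:R = nk 2.
Proof.
move=> pp pr ne; rewrite -(card_nk (dim_add2 pp pr ne)); last by lia.
by congr (_%:R); apply: eq_card => U; rewrite !inE subv_add.
Qed.

Lemma points_nk p : point p ->
  #|[pred U | (\dim U == k) && (p <= U)%VS]|%:R = nk 1.
Proof. by move=> /eqP pp; apply: card_nk => //; lia. Qed.

Section Cross.
Variables (Y : {set {vspace V}}) (p : {vspace V}).
Hypotheses (intY : intersecting Y) (pp : point p).

Let A : pred {vspace V} := [pred U | (U \in Y) && (p <= U)%VS].
Let B : pred {vspace V} := [pred U | (U \in Y) && ~~ (p <= U)%VS].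
Let P : pred {vspace V} := [pred r | point r && (r != p)].
Let a r : rat := #|[pred U | A U && (r <= U)%VS]|%:R.
Let b r : rat := #|[pred U | B U && (r <= U)%VS]|%:R.
Let nA : rat := #|A|%:R.
Let nB : rat := #|B|%:R.
(** The mean of [a] over the points other than [p], so that [u] has sum zero. *)
Let avg := nA * (qn k - 1) / (qn (2 * k) - 1).
Let u r := a r - avg.
Let X := \sum_(r | P r) u r ^+ 2.

Let dimY U : U \in Y -> \dim U = k. Proof. by case: intY => h _; apply: h. Qed.

Let sum_a : \sum_(r | P r) a r = nA * (qn k - 1).
Proof.
transitivity (\sum_(r | P r) a r * 1); first by apply: eq_bigr => r _;
  rewrite mulr1.
rewrite -(incidence_exchange (fun U r => (r <= U)%VS)) mulr_natl -sumr_const.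
apply: eq_bigr => U /andP[UY pU].
by rewrite sumr_const (card_other_points U pp) pU dimY.
Qed.

Let sum_b : \sum_(r | P r) b r = nB * qn k.
Proof.
transitivity (\sum_(r | P r) b r * 1); first by apply: eq_bigr => r _;
  rewrite mulr1.
rewrite -(incidence_exchange (fun U r => (r <= U)%VS)) mulr_natl -sumr_const.
apply: eq_bigr => U /andP[UY /negbTE pU].
by rewrite sumr_const (card_other_points U pp) pU dimY // subr0.
Qed.

(** A member through [p] and a member missing [p] share a point, necessarily other than [p]; the
    right side counts all such common points. *)
Let sum_ab : nA * nB <= \sum_(r | P r) a r * b r.
Proof.
rewrite -(incidence_exchange (fun U r => (r <= U)%VS)) mulr_natl -sumr_const.
apply: ler_sum => U /andP[UY pU].
apply: (@le_trans _ _ (\sum_(S | B S) \sum_(r | (P r && (r <= U)%VS) && (r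
  <= S)%VS) 1)).
  rewrite /nB -sum1_card natr_sum; apply: ler_sum => S /andP[SY pS].
  have [r pr] := ex_point (intY.2 _ _ UY SY); rewrite subv_cap => /andP[rU rS].
  rewrite (bigD1 r) /= ?pr ?rU ?rS ?lerDl ?sumr_ge0 // ?andbT.
  by rewrite /P /= pr; apply: contraNneq pS => <-.
rewrite (incidence_exchange (fun U r => (r <= U)%VS) B [pred r | P r && (r
  <= U)%VS]).
by apply: ler_sum => r _; rewrite mulr1.
Qed.

Let card_P : #|P|%:R = qn (2 * k) - 1.
Proof.
rewrite -[in RHS](dimrv F (2 * k)).
have := card_other_points fullv pp; rewrite subvf => <-; congr (_%:R).
by apply: eq_card => r; rewrite !inE subvf andbT.
Qed.

Let qn2k : 0 < qn (2 * k) - 1.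
Proof.
have h : q ^+ 1 < q ^+ (2 * k) by rewrite qX_lt //; lia.
have -> : qn (2 * k) - 1 = (q ^+ (2 * k) - q ^+ 1) / (q - 1).
  by rewrite /qnum expr1; field; rewrite gt_eqF ?qsub1_gt0.
by rewrite divr_gt0 ?qsub1_gt0 // subr_gt0.
Qed.

Let sum_u : \sum_(r | P r) u r = 0.
Proof.
rewrite sumrB sum_a sumr_const -mulr_natl card_P /avg; field.
by rewrite gt_eqF.
Qed.

Let XE : X = \sum_(r | P r) u r * a r.
Proof.
transitivity (\sum_(r | P r) (u r * a r - avg * u r)).
  by apply: eq_bigr => r _; rewrite /u; ring.
by rewrite sumrB -mulr_sumr sum_u mulr0 subr0.
Qed.

Let X_ge0 : 0 <= X. Proof. by apply: sumr_ge0 => r _; apply: sqr_ge0. Qed.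

(** Centring [a] subtracts [avg * (nB * qn k)] from [sum_ab], and this is at most
    [nA * nB / (q - 1)]. *)
Let sum_ub_ge : (q - 2) / (q - 1) * (nA * nB) <= \sum_(r | P r) u r * b r.
Proof.
have -> : \sum_(r | P r) u r * b r
  = \sum_(r | P r) a r * b r - avg * (nB * qn k).
  rewrite -sum_b mulr_sumr -sumrB; apply: eq_bigr => r _; rewrite /u; ring.
have AB : 0 <= nA * nB by rewrite mulr_ge0.
have q1 := qsub1_gt0.
suff h : (qn k - 1) / (qn (2 * k) - 1) * qn k <= (q - 1)^-1.
  have := ler_wpM2l AB h.
  have -> : nA * nB * ((qn k - 1) / (qn (2 * k) - 1) * qn k)
    = avg * (nB * qn k).
    by rewrite /avg; ring.
  have -> : (q - 2) / (q - 1) * (nA * nB) = nA * nB - nA * nB * (q - 1)^-1.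
    by field; rewrite gt_eqF.
  by move: sum_ab; lra.
rewrite mulrAC ler_pdivrMr // /qnum mulnC exprM.
have qk : q <= q ^+ k by rewrite -{1}[q]expr1 qX_le //; lia.
set x := q ^+ k in qk *.
rewrite -(ler_pM2r q1) -(ler_pM2r q1).
have -> : ((x - 1) / (q - 1) - 1) * ((x - 1) / (q - 1)) * (q - 1) * (q - 1)
  = (x - q) * (x - 1) by field; rewrite gt_eqF.
have -> : (q - 1)^-1 * ((x ^+ 2 - 1) / (q - 1) - 1) * (q - 1) * (q - 1)
  = x ^+ 2 - q by field; rewrite gt_eqF.
have := q_gt1 F; nra.
Qed.

(** Cauchy-Schwarz over [B], then [B] is enlarged to all [k]-spaces, where [design_bilinear] gives
    [(nk 1 - nk 2) * X] because [u] has sum zero. *)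
Let sum_ub_le : (\sum_(r | P r) u r * b r) ^+ 2 <= nB * (nk 1 * X).
Proof.
have -> : \sum_(r | P r) u r * b r
  = \sum_(S | B S) \sum_(r | P r && (r <= S)%VS) u r.
  by rewrite incidence_exchange; apply: eq_bigr => r _; rewrite mulrC.
apply: le_trans (sqr_sum_le _ _) _; rewrite ler_wpM2l //.
pose K : pred {vspace V} := [pred S | \dim S == k].
apply: (@le_trans _ _ (\sum_(S | K S) (\sum_(r | P r && (r
  <= S)%VS) u r) ^+ 2)).
  rewrite [leRHS](bigID B) /=.
  rewrite [X in _ <= X + _](eq_bigl B); last first.
    move=> S; rewrite /K /B /= andbC; case SY: (S \in Y) => //=.
    by rewrite dimY ?eqxx ?andbT.
  by rewrite lerDl sumr_ge0 // => S _; apply: sqr_ge0.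
under eq_bigr do rewrite expr2.
rewrite (@design_bilinear _ _ _ _ K P (nk 1) (nk 2)).
- rewrite sum_u !mulr0 add0r (eq_bigr (fun r => u r ^+ 2)) ?ler_wpM2r //.
  by rewrite lerBlDr lerDl nk_ge0.
- by move=> r /andP[pr _]; apply: points_nk.
- by move=> r s /andP[pr _] /andP[ps _]; apply: pairs_nk.
Qed.

(** As for [sum_ub_le], but with [A] enlarged only to the [k]-spaces through [p]; this gains the
    factor from [nk 1] down to [q * nk 2]. *)
Let X_le : X ^+ 2 <= nA * (q * nk 2 * X).
Proof.
rewrite {1}XE.
have -> : \sum_(r | P r) u r * a r
  = \sum_(U | A U) \sum_(r | P r && (r <= U)%VS) u r.
  by rewrite incidence_exchange; apply: eq_bigr => r _; rewrite mulrC.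
apply: le_trans (sqr_sum_le _ _) _; rewrite ler_wpM2l //.
pose K : pred {vspace V} := [pred S | (\dim S == k) && (p <= S)%VS].
apply: (@le_trans _ _ (\sum_(S | K S) (\sum_(r | P r && (r
  <= S)%VS) u r) ^+ 2)).
  rewrite [leRHS](bigID A) /=.
  rewrite [X in _ <= X + _](eq_bigl A); last first.
    move=> S; rewrite /K /A /= andbC; case SY: (S \in Y) => //=.
    by rewrite dimY ?eqxx ?andbT //= andbb.
  by rewrite lerDl sumr_ge0 // => S _; apply: sqr_ge0.
under eq_bigr do rewrite expr2.
rewrite incidence_bilinear.
(* The span of [p], [r], [s] has dimension 2 or 3. The constant part [nk 3] disappears on summation
   since [u] has sum zero, leaving the pairs collinear with [p]. *)
have cnt r s : P r -> P s ->
    #|[pred U | K U && ((r <= U)%VS && (s <= U)%VS)]|%:R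
    = nk 3 + (nk 2 - nk 3) * (s <= p + r)%VS%:R.
  move=> /andP[pr rp] /andP[ps sp].
  have d2 : \dim (p + r) = 2%N by rewrite dim_add2 // eq_sym.
  have [le|nle] := boolP (s <= p + r)%VS.
    rewrite mulr1 addrCA subrr addr0 -(card_nk d2); last by lia.
    congr (_%:R); apply: eq_card => U; rewrite !inE subv_add -!andbA.
    case: (\dim U == k) => //=; case pU: (p <= U)%VS => //=.
    case rU: (r <= U)%VS => //=; apply: (subv_trans le).
    by rewrite subv_add pU rU.
  have d3 : \dim (p + r + s) = 3%N by rewrite dim_add_point ?d2.
  rewrite mulr0 addr0 -(card_nk d3); last by lia.
  by congr (_%:R); apply: eq_card => U; rewrite !inE !subv_add -!andbA.
have collC r s : P r -> P s -> (s <= p + r)%VS = (r <= p + s)%VS.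
  have half r' s' : P r' -> P s' -> (s' <= p + r')%VS -> (r' <= p + s')%VS.
    move=> /andP[pr rp] /andP[ps sp] le.
    suff /eqP -> : (p + s' == p + r')%VS by rewrite addvSr.
    rewrite eqEdim subv_add addvSl le !dim_add2 //; by rewrite eq_sym.
  by move=> Pr Ps; apply/idP/idP; apply: half.
(* The line [p + r] has [q + 1] points; [p] is excluded, [r] itself is counted. *)
have cntc r : P r -> #|[pred s | P s && (s <= p + r)%VS]|%:R = q.
  move=> /andP[pr rp]; rewrite (card_other_points _ pp) addvSl dim_add2 //;
    last by rewrite eq_sym.
  by rewrite /qnum /=; field; rewrite gt_eqF ?qsub1_gt0.
have -> : \sum_(r | P r) \sum_(s | P s)
     #|[pred U | K U && ((r <= U)%VS && (s <= U)%VS)]|%:R * (u r * u s)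
  = (nk 2 - nk 3) * \sum_(r | P r) \sum_(s | P s && (s <= p + r)%VS) u r * u s.
  transitivity (\sum_(r | P r) \sum_(s | P s) (nk 3 * u r * u s
      + (nk 2 - nk 3) * ((s <= p + r)%VS%:R * (u r * u s)))).
    apply: eq_bigr => r Pr; apply: eq_bigr => s Ps; rewrite cnt //; ring.
  under eq_bigr => r _ do rewrite big_split /= -!mulr_sumr sum_u mulr0 add0r.
  rewrite -mulr_sumr; congr (_ * _); apply: eq_bigr => r _.
  rewrite [RHS]big_mkcondr /=; apply: eq_bigr => s _.
  by case: (s <= p + r)%VS; rewrite ?mul1r ?mul0r.
have h0 : 0 <= nk 2 - nk 3 by rewrite subr_ge0 nk_le //; lia.
apply: (@le_trans _ _ ((nk 2 - nk 3) * (q * X))); last first.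
  rewrite -mulrA [q * (nk 2 * X)]mulrCA ler_wpM2r ?mulr_ge0 // ?lerBlDr
    ?lerDl ?nk_ge0 //.
rewrite ler_wpM2l //.
(* Bound [u r * u s] by the mean of the two squares; as collinearity with [p] is symmetric
   ([collC]), each half contributes [q * X / 2]. *)
apply: (@le_trans _ _ (\sum_(r | P r) \sum_(s | P s && (s <= p + r)%VS)
    (u r ^+ 2 / 2 + u s ^+ 2 / 2))).
  apply: ler_sum => r _; apply: ler_sum => s _.
  have := sqr_ge0 (u r - u s); lra.
under eq_bigr => r _ do rewrite big_split /=.
rewrite big_split /=.
have -> : \sum_(r | P r) \sum_(s | P s && (s <= p + r)%VS) u s ^+ 2 / 2
  = \sum_(s | P s) \sum_(r | P r && (r <= p + s)%VS) u s ^+ 2 / 2.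
  rewrite (exchange_big_dep P) /= => [|r s _ /andP[]//].
  apply: eq_bigr => s Ps; apply: eq_bigl => r.
  by case Pr: (P r) => //=; rewrite Ps /= collC.
have -> : \sum_(r | P r) \sum_(s | P s && (s <= p + r)%VS) u r ^+ 2 / 2
  = q * X / 2.
  rewrite (eq_bigr (fun r => q * (u r ^+ 2 / 2))); last first.
    by move=> r Pr; rewrite sumr_const -[in RHS](cntc _ Pr) mulr_natl.
  by rewrite -mulr_sumr -mulr_suml mulrA.
lra.
Qed.

(** Square [sum_ub_ge], compare it with [sum_ub_le], insert the bound on [X] from [X_le], and cancel
    [nA * nB]. *)
Lemma cross_bound :
  ((q - 2) / (q - 1)) ^+ 2 * (degree Y p * (#|Y|%:R - degree Y p))
  <= q * nk 1 * nk 2.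
Proof.
have -> : #|Y|%:R - degree Y p = nB.
  rewrite -(cardID [pred U | (p <= U)%VS] Y) natrD /degree.
  have -> : #|[predI Y & [pred U | (p <= U)%VS]]|
    = #|[pred U | U \in Y & (p <= U)%VS]|.
    by apply: eq_card => U; rewrite !inE.
  rewrite addrAC subrr add0r; congr (_%:R); apply: eq_card => U;
    rewrite !inE andbC //.
rewrite -/nA.
have RHS0 : 0 <= q * nk 1 * nk 2 by rewrite !mulr_ge0 ?nk_ge0.
have [Z|nz] := eqVneq (nA * nB) 0; first by rewrite Z mulr0.
have AB : 0 < nA * nB by rewrite lt_def nz mulr_ge0.
have A0 : 0 <= nA by [].
have B0 : 0 <= nB by [].
have XA : X <= nA * (q * nk 2).
  have [->|xn] := eqVneq X 0; first by rewrite !mulr_ge0 ?nk_ge0.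
  have X0 : 0 < X by rewrite lt_def xn.
  by rewrite -(ler_pM2r X0) -expr2 -mulrA.
have c0 : 0 <= q - 2 by rewrite subr_ge0 ler_nat finNzRing_gt1.
rewrite -(ler_pM2l AB).
have l1 : 0 <= (q - 2) / (q - 1) * (nA * nB)
  by rewrite mulr_ge0 ?divr_ge0 // ltW ?qsub1_gt0.
have : ((q - 2) / (q - 1) * (nA * nB)) ^+ 2 <= (\sum_(r | P r) u r * b r) ^+ 2.
  by rewrite lerXn2r ?nnegrE // (le_trans l1).
move=> h; have := le_trans h sum_ub_le => h2.
have h3 : nB * (nk 1 * X) <= nB * (nk 1 * (nA * (q * nk 2))).
  by rewrite !ler_wpM2l ?nk_ge0.
have := le_trans h2 h3; rewrite exprMn.
lra.
Qed.

End Cross.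
End PointDegrees.

(** * The fourth moment of centred point weights over the [k]-spaces *)

Section FourthMoment.
Variables (F : finFieldType) (k : nat).
Hypothesis k_gt4 : (4 < k)%N.
Local Notation V := 'rV[F]_(2 * k).
Local Notation q := (#|F|%:R : rat).
Local Notation nk := (nabove F (2 * k) k).
Local Notation qn := (qnum F).
Implicit Types (U W S J p r s : {vspace V}).

(** Unlike [nabove], this is 0 when [\dim J] exceeds [d], which is what makes the system solved in
    [fourth_moment] triangular. *)
Definition nspan (d : nat) J : rat := #|[pred U | (\dim U == d) && (J
  <= U)%VS]|%:R.

Lemma nspanE d J j : \dim J = j ->
  nspan d J = if (j <= d)%N then nabove F (2 * k) d j else 0.
Proof.
move=> <-; case: leqP => [/card_above //|lt]; rewrite /nspan.
rewrite (_ : #|_| = 0%N) //; apply: eq_card0 => U; rewrite !inE.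
by apply: contraTF lt => /andP[/eqP <- /dimvS]; rewrite leqNgt.
Qed.

Lemma nabove_self d : nabove F (2 * k) d d = 1.
Proof. by rewrite /nabove big_geq. Qed.

(** Downward induction on [j] through [naboveS], starting from [j = 2k - 1]. *)
Lemma nabove_hyperplane j : (j < 2 * k)%N ->
  nabove F (2 * k) (2 * k - 1) j = qn (2 * k - j).
Proof.
move En : (2 * k)%N => n; have q1 := qsub1_gt0 F.
have q0 : q != 0 by rewrite gt_eqF ?q_gt0.
move Em : (n - j)%N => m; elim: m j Em => [|m IH] j Em lt; first by lia.
have [E|ne] := eqVneq j (n - 1)%N.
  rewrite E /nabove big_geq // (_ : m.+1 = 1%N); last by lia.
  by rewrite /qnum expr1 divff // gt_eqF.
have := @naboveS F n (n - 1) j; rewrite (IH j.+1); [|by lia|by lia].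
move=> /(_ ltac:(lia)).
have -> : (n - 1 = m + j)%N by lia.
have -> : (n = m.+1 + j)%N by lia.
have qm : q ^+ m - 1 != 0.
  have := @qX_lt F 0 m; rewrite expr0 => /(_ ltac:(lia)) h.
  by rewrite gt_eqF // subr_gt0.
have qj : q ^+ j != 0 by rewrite expf_neq0.
rewrite /qnum !exprD exprS => h.
apply: (mulIf qm); apply: (mulIf qj).
have -> : nabove F (m.+1 + j) (m + j) j * (q ^+ m - 1) * q ^+ j =
  nabove F (m.+1 + j) (m + j) j * (q ^+ m * q ^+ j - q ^+ j) by ring.
by rewrite h; field; rewrite gt_eqF.
Qed.

Section Weights.
Variable w : {vspace V} -> rat.
Hypothesis w0 : \sum_(p | point p) w p = 0.

Definition wsum U : rat := \sum_(p | point p && (p <= U)%VS) w p.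

Let M := \sum_(p | point p) w p ^+ 2.
Let R1 := \sum_(p | point p) w p ^+ 4.

(** The four points come as two pairs, so that [wsum U ^+ 4] is the square of a sum over pairs and
    [incidence_bilinear] applies. *)
Definition span4 (x y : {vspace V} * {vspace V}) := (x.1 + x.2 + (y.1 +
  y.2))%VS.

Lemma moment4 d : \sum_(U | \dim U == d) wsum U ^+ 4 =
  \sum_(x : {vspace V} * {vspace V} | point x.1 && point x.2)
  \sum_(y : {vspace V} * {vspace V} | point y.1 && point y.2)
    nspan d (span4 x y) * ((w x.1 * w x.2) * (w y.1 * w y.2)).
Proof.
pose B2 := [pred x : {vspace V} * {vspace V} | point x.1 && point x.2].
pose r2 U (x : {vspace V} * {vspace V}) := (x.1 <= U)%VS && (x.2 <= U)%VS.
have sq U : wsum U ^+ 2 = \sum_(x | B2 x && r2 U x) w x.1 * w x.2.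
  rewrite expr2 /wsum mulr_suml; under eq_bigr do rewrite mulr_sumr.
  rewrite pair_big_dep /=; apply: eq_bigl => x.
  by rewrite /r2 !andbA; congr (_ && _); rewrite -!andbA; congr (_ && _);
    rewrite andbC.
under eq_bigr => U _.
  rewrite -[4%N]/(2 * 2)%N exprM expr2 sq; over.
rewrite (incidence_bilinear r2 [pred U | \dim U == d] B2).
apply: eq_bigr => x _; apply: eq_bigr => y _; congr (_%:R * _).
by apply: eq_card => U; rewrite !inE /r2 /span4 !subv_add.
Qed.

Lemma dim_span4 x y : point x.1 -> point x.2 -> point y.1 -> point y.2 ->
  (0 < \dim (span4 x y) <= 4)%N.
Proof.
move=> /eqP a /eqP b /eqP c /eqP d; apply/andP; split.
  have : (x.1 <= span4 x y)%VS by rewrite /span4 -!addvA addvSl.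
  by move/dimvS; rewrite a.
apply: leq_trans (dimv_add_leqif _ _) _.
have := leq_add (leq_of_leqif (dimv_add_leqif x.1 x.2)) (leq_of_leqif
  (dimv_add_leqif y.1 y.2)).
by rewrite a b c d.
Qed.

(** Apply [power_sum4_le] on each line, with [m = q + 1] points, and sum. Two points lie on exactly
    one line, so [design_bilinear] holds with [e2 = 1]; by [w0] the products [ps 3 * ps 1] leave
    only [(l - 1) * R1]. *)
Lemma sum_lines4 (l := nabove F (2 * k) 2 1) :
  \sum_(U | \dim U == 2) wsum U ^+ 4
    <= (q ^+ 2 + 3 * q - 1) * M ^+ 2 + (l - 4) * R1.
Proof.
pose P (U : {vspace V}) := [pred p | point p && (p <= U)%VS].
pose ps e U := \sum_(p | P U p) w p ^+ e.
have c1 : {in [pred p | point p], forall p,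
    #|[pred U | (\dim U == 2) && (p <= U)%VS]|%:R = l}.
  by move=> p pp; rewrite -[LHS]/(nspan 2 p) (nspanE 2 (eqP pp)).
have c2 : {in [pred p | point p] &, forall p r, p != r ->
    #|[pred U | (\dim U == 2) && ((p <= U)%VS && (r <= U)%VS)]|%:R = 1 :> rat}.
  move=> p r pp pr ne; transitivity (nspan 2 (p + r)).
    by congr (_%:R); apply: eq_card => U; rewrite !inE subv_add.
  by rewrite (nspanE 2 (dim_add2 pp pr ne)) nabove_self.
have bil e f : \sum_(U | \dim U == 2) ps e U * ps f U =
   (\sum_(p | point p) w p ^+ e) * (\sum_(p | point p) w p ^+ f)
   + (l - 1) * \sum_(p | point p) w p ^+ e * w p ^+ f.
  have := design_bilinear (fun p => w p ^+ e) (fun p => w p ^+ f) c1 c2.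
  by rewrite mul1r.
have lin : \sum_(U | \dim U == 2) ps 4 U = l * R1.
  rewrite /ps (incidence_exchange (fun U p => (p
    <= U)%VS) [pred U | \dim U == 2] [pred p | point p]).
  by rewrite mulr_sumr; apply: eq_bigr => p pp; rewrite c1.
have b31 : \sum_(U | \dim U == 2) ps 3 U * ps 1 U = (l - 1) * R1.
  rewrite bil (_ : \sum_(p | point p) w p ^+ 1 = 0) ?mulr0 ?add0r //.
  by congr (_ * _); apply: eq_bigr => p _; ring.
have b22 : \sum_(U | \dim U == 2) ps 2 U * ps 2 U = M ^+ 2 + (l - 1) * R1.
  rewrite bil -expr2; congr (_ + _ * _); apply: eq_bigr => p _; ring.
have key U : \dim U == 2%N -> wsum U ^+ 4 <= 4 * (ps 3 U * ps 1 U) - 3 * ps 4 U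
   + (q ^+ 2 + 3 * q - 1) * (ps 2 U * ps 2 U - ps 4 U).
  move=> /eqP dU.
  have : ps 1 U ^+ 4 - 4 * (ps 3 U * ps 1 U) + 3 * ps 4 U
    <= (#|P U|%:R ^+ 2 + #|P U|%:R - 3) * (ps 2 U ^+ 2 - ps 4 U).
    exact: power_sum4_le.
  rewrite card_points dU.
  have -> : wsum U = ps 1 U by [].
  have -> : qn 2 = q + 1 by rewrite /qnum; field; rewrite gt_eqF ?qsub1_gt0.
  have -> : (q + 1) ^+ 2 + (q + 1) - 3 = q ^+ 2 + 3 * q - 1 by ring.
  rewrite [ps 2 U ^+ 2]expr2; lra.
apply: le_trans (ler_sum _ key) _.
rewrite big_split /= sumrB -!mulr_sumr sumrB b31 b22 lin.
have R0 : 0 <= R1 by apply: sumr_ge0 => p _; rewrite exprn_even_ge0.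
have : 0 <= (q ^+ 2 + 3 * q - 1) * R1 by rewrite mulr_ge0 //;
  have := q_gt1 F; nra.
lra.
Qed.

(** The hyperplane terms and the point terms each contribute at most [nk 1 * T ^+ 2 * M], the line
    terms the rest. The scale [q ^+ (k - 1)] is the one found in [wsum_hyperplane]. *)
Lemma fourth_moment (T : rat) :
  (forall p, point p -> w p ^+ 2 <= T ^+ 2) ->
  (forall H, \dim H = (2 * k - 1)%N -> wsum H ^+ 2
    <= (q ^+ (k - 1) * T) ^+ 2) ->
  \sum_(U | \dim U == k) wsum U ^+ 4
    <= 2 * nk 1 * T ^+ 2 * M + nk 2 * (q ^+ 2 + 3 * q - 1) * M ^+ 2.
Proof.
move=> wT wH.
have k4 : (4 <= k)%N by lia.
have k4h : (4 <= 2 * k - 1)%N by lia.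
have k2 : (2 < 2 * k)%N by lia.
have eX : (k - 1 + (k - 1) + (2 * k - 2) = 2 * k - 4 + (k + k))%N by lia.
have k32 : (3 < k)%N by []; have k22 : (2 < k)%N by apply: ltnW.
have k12 : (1 < k)%N by apply: ltnW.
have qk := q_gt0 F; have qpos i : 0 < q ^+ i by rewrite exprn_gt0.
pose h := nabove F (2 * k) (2 * k - 1).
have hd j : (j.+1 < 2 * k)%N -> h j - h j.+1 = q ^+ (2 * k - j.+1).
  move=> lt; rewrite /h !nabove_hyperplane //; last by lia.
  rewrite /qnum (_ : (2 * k - j = (2 * k - j.+1).+1)%N) ?exprS; last by lia.
  by field; rewrite gt_eqF ?qsub1_gt0.
have h34 : h 3 - h 4 = q ^+ (2 * k - 4) by apply: hd; lia.
have h23 : h 2 - h 3 = q * q ^+ (2 * k - 4).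
  by rewrite hd; [rewrite -exprS; congr (_ ^+ _); lia|lia].
have h12 : h 1%N - h 2 = q ^+ 2 * q ^+ (2 * k - 4).
  by rewrite hd; [rewrite -exprD; congr (_ ^+ _); lia|lia].
(* [A], [B], [C], [E] solve the triangular system expressing the number of
   [k]-spaces above a [j]-space, 1 <= j <= 4, through those of hyperplanes,
   lines and points; the constant [A] is killed by [w0]. *)
pose l := nabove F (2 * k) 2 1.
pose B := (nk 3 - nk 4) / q ^+ (2 * k - 4).
pose A := nk 4 - B * h 4.
pose C := nk 2 - A - B * h 2.
pose E := nk 1%N - A - B * h 1%N - C * l.
have Bq : B * q ^+ (2 * k - 4) = nk 3 - nk 4 by rewrite divfK // gt_eqF.
have A3 : nk 3 = A + B * h 3.
  by rewrite /A -(subrK (nk 4) (nk 3)) -Bq -h34; ring.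
have CE : C = nk 2 - nk 3 - q * (nk 3 - nk 4).
  have : B * (h 2 - h 3) = q * (nk 3 - nk 4) by rewrite h23 -Bq; ring.
  by rewrite /C; move: A3; lra.
have EE : E + C * l = nk 1%N - nk 2 + C - q ^+ 2 * (nk 3 - nk 4).
  have : B * (h 1%N - h 2) = q ^+ 2 * (nk 3 - nk 4) by rewrite h12 -Bq; ring.
  have : C = nk 2 - A - B * h 2 by [].
  by rewrite /E; lra.
have n0 j : 0 <= nk j by apply: nk_ge0.
have n43 : nk 4 <= nk 3 by apply: nk_le.
have n32 : q ^+ k * nk 3 <= nk 2 by apply: nk_ratio.
have n21 : q ^+ k * nk 2 <= nk 1 by apply: nk_ratio.
have B0 : 0 <= B by rewrite divr_ge0 ?subr_ge0 // ltW.
have q1 := q_gt1 F.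
have q2k : q ^+ 2 <= q ^+ k by apply: qX_le; apply: ltnW.
(* [C] is at least [nk 2 - (q + 1) * nk 3], and [q + 1 <= q ^+ 2 <= q ^+ k]. *)
have C0 : 0 <= C.
  have : q ^+ 2 * nk 3 <= q ^+ k * nk 3 by rewrite ler_wpM2r.
  have : (q + 1) * nk 3 <= q ^+ 2 * nk 3.
    rewrite ler_wpM2r //.
    have : 2 <= q by rewrite ler_nat finNzRing_gt1.
    nra.
  have : 0 <= q * nk 4 by rewrite mulr_ge0 // ltW.
  rewrite CE; lra.
have Cn : C <= nk 2.
  have : 0 <= q * (nk 3 - nk 4) by rewrite mulr_ge0 ?subr_ge0 // ltW.
  by rewrite CE; have := n0 3; lra.
have idn x y : point x.1 && point x.2 -> point y.1 && point y.2 ->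
    nspan k (span4 x y) = A + B * nspan (2 * k - 1) (span4 x y)
      + C * nspan 2 (span4 x y) + E * nspan 1 (span4 x y).
  move=> /andP[a b] /andP[c d]; have := dim_span4 a b c d.
  move Ej : (\dim (span4 x y)) => j /andP[j0 j4].
  have jk : (j <= k)%N by apply: leq_trans j4 _.
  have jh : (j <= 2 * k - 1)%N by apply: leq_trans j4 _.
  rewrite !(nspanE _ Ej) jk jh.
  case: j j0 j4 {Ej jk jh} => [|[|[|[|[|j]]]]] //= _ _.
  - by rewrite !nabove_self -/l -/h /E; ring.
  - by rewrite !nabove_self -/h /C; ring.
  - by rewrite -/h A3; ring.
  - by rewrite -/h /A; ring.
have dec : \sum_(U | \dim U == k) wsum U ^+ 4 =
    B * (\sum_(U | \dim U == (2 * k - 1)%N) wsum U ^+ 4)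
    + C * (\sum_(U | \dim U == 2) wsum U ^+ 4)
    + E * (\sum_(U | \dim U == 1%N) wsum U ^+ 4).
  rewrite !moment4 !mulr_sumr -!big_split /=.
  transitivity (\sum_(x : {vspace V} * {vspace V} | point x.1 && point x.2)
     (A * (w x.1 * w x.2) * (\sum_(y : {vspace V} * {vspace V} | point y.1 &&
       point y.2) w y.1 * w y.2)
     + \sum_(y : {vspace V} * {vspace V} | point y.1 && point y.2)
         (B * nspan (2 * k - 1) (span4 x y) + C * nspan 2 (span4 x y)
           + E * nspan 1 (span4 x y)) * ((w x.1 * w x.2) * (w y.1 * w y.2)))).
    apply: eq_bigr => x Px; rewrite mulr_sumr -big_split /=.
    by apply: eq_bigr => y Py; rewrite idn //; ring.
  have -> : \sum_(y : {vspace V} * {vspace V} | point y.1 && point y.2) w y.1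
    * w y.2 = 0.
    rewrite -(pair_big (@point F (2 * k)) (@point F (2 * k)) (fun p r => w p
      * w r)) /=.
    by under eq_bigr do rewrite -mulr_sumr w0 mulr0; rewrite big1.
  apply: eq_bigr => x Px; rewrite mulr0 add0r !mulr_sumr -!big_split /=.
  by apply: eq_bigr => y Py; ring.
have pt1 : \sum_(U | \dim U == 1%N) wsum U ^+ 4 = R1.
  apply: eq_bigr => p pp; congr (_ ^+ 4);
    rewrite /wsum (big_pred1 p) // => r /=.
  case pr: (point r) => /=; first by rewrite sub_point.
  by symmetry; apply: contraFF pr => /eqP ->.
have M0 : 0 <= M by apply: sumr_ge0 => p _; apply: sqr_ge0.
have R1le : R1 <= T ^+ 2 * M.
  rewrite mulr_sumr; apply: ler_sum => p pp.
  by rewrite -[4%N]/(2 + 2)%N exprD ler_wpM2r ?sqr_ge0 ?wT.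
have R0 : 0 <= R1 by apply: sumr_ge0 => p _; rewrite exprn_even_ge0.
(* Hyperplanes through points form a 2-design, and [w] has sum zero, so the factor is
   [h 1 - h 2]. *)
have H2 : \sum_(U | \dim U == (2 * k - 1)%N) wsum U ^+ 2 = q ^+ (2 * k - 2) * M.
  under eq_bigr do rewrite expr2.
  rewrite (@design_bilinear _ _ _ (fun U p => (p
    <= U)%VS) [pred U | \dim U == (2 * k - 1)%N]
     [pred p | point p] (h 1%N) (h 2)).
  - by rewrite w0 !mulr0 add0r hd.
  - by move=> p pp; rewrite -[LHS]/(nspan (2 * k - 1) p) (nspanE _ (eqP pp))
    ifT // (leq_trans _ k4h).
  - move=> p r pp pr ne; transitivity (nspan (2 * k - 1) (p + r)).
      by congr (_%:R); apply: eq_card => U; rewrite !inE subv_add.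
    by rewrite (nspanE _ (dim_add2 pp pr ne)) ifT // (leq_trans _ k4h).
have H4 : \sum_(U | \dim U == (2 * k - 1)%N) wsum U ^+ 4
    <= (q ^+ (k - 1) * T) ^+ 2 * (q ^+ (2 * k - 2) * M).
  rewrite -H2 mulr_sumr; apply: ler_sum => U /eqP dU.
  by rewrite -[4%N]/(2 + 2)%N exprD ler_wpM2r ?sqr_ge0 ?wH.
(* The powers of [q] combine to [B * q ^+ (2 * k - 4) * q ^+ (2 * k)]; the first two factors are
   [nk 3 - nk 4], and two uses of [nk_ratio] absorb the last. *)
have BH : B * (\sum_(U | \dim U == (2 * k - 1)%N) wsum U ^+ 4)
  <= nk 1 * (T ^+ 2 * M).
  apply: le_trans (ler_wpM2l B0 H4) _.
  have -> : B * ((q ^+ (k - 1) * T) ^+ 2 * (q ^+ (2 * k - 2) * M))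
    = (B * q ^+ (2 * k - 4)) * (q ^+ k * q ^+ k) * (T ^+ 2 * M).
    have -> : (q ^+ (k - 1) * T) ^+ 2 * (q ^+ (2 * k - 2) * M)
      = (q ^+ (k - 1) * q ^+ (k - 1) * q ^+ (2 * k - 2)) * (T ^+ 2 * M) by ring.
    have -> : q ^+ (k - 1) * q ^+ (k - 1) * q ^+ (2 * k - 2) =
      q ^+ (2 * k - 4) * (q ^+ k * q ^+ k).
      by rewrite -!exprD eX.
    ring.
  apply: ler_wpM2r; first by rewrite mulr_ge0 ?sqr_ge0.
  rewrite Bq.
  apply: (@le_trans _ _ (q ^+ k * (q ^+ k * nk 3))).
    have := n0 4; have : 0 <= q ^+ k * q ^+ k by rewrite mulr_ge0 // ltW.
    move=> u v; have := mulr_ge0 u v; lra.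
  by apply: le_trans n21; rewrite ler_wpM2l // ltW.
have L4 := ler_wpM2l C0 sum_lines4.
rewrite dec pt1.
have e1 : C * ((q ^+ 2 + 3 * q - 1) * M ^+ 2)
  <= nk 2 * ((q ^+ 2 + 3 * q - 1) * M ^+ 2).
  by rewrite ler_wpM2r // mulr_ge0 ?sqr_ge0 //; nra.
(* The point terms are joined with the [R1] part of the line bound: [E] and [C * l] are large
   separately, and [EE] controls their sum. *)
have e2 : (E + C * l - 4 * C) * R1 <= nk 1 * R1.
  rewrite ler_wpM2r // EE.
  have : 0 <= q ^+ 2 * (nk 3 - nk 4) by rewrite mulr_ge0 ?sqr_ge0 ?subr_ge0.
  by have := n0 2; lra.
have e3 : nk 1 * R1 <= nk 1 * (T ^+ 2 * M) by rewrite ler_wpM2l.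
have -> : nk 2 * (q ^+ 2 + 3 * q - 1) * M ^+ 2
  = nk 2 * ((q ^+ 2 + 3 * q - 1) * M ^+ 2) by ring.
have -> : 2 * nk 1 * T ^+ 2 * M = 2 * (nk 1 * (T ^+ 2 * M)) by ring.
move: L4; rewrite -/l mulrDr.
have -> : C * ((l - 4) * R1) = (E + C * l - 4 * C) * R1 - E * R1 by ring.
lra.
Qed.

End Weights.
End FourthMoment.

(** * Numerical estimates *)

(** Here [Q] stands for [qn k], [n1] and [n2] for [nk 1] and [nk 2], and [y] for the size of the
    family. Each of the two terms on the right of the last hypothesis is at most [M ^+ 4 / 2], the
    second strictly less. *)
Lemma moment_contradiction (R : realFieldType) (q c Q n1 n2 N T y M : R) :
  3 <= q -> c = (q - 2) / (q - 1) -> 0 < Q ->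
  (q - 1) ^+ 2 * q ^+ 2 / 2 <= c ^+ 2 * Q ->
  0 < n2 -> N = Q * n2 -> 0 <= n1 -> n1 <= 41%:R / 40%:R * ((q - 1) * N) ->
  T = q ^+ 2 * n1 / (3 * (c ^+ 2 * Q)) ->
  (1 + 3 * q^-1) * N <= y -> c * y ^+ 2 <= M ->
  M ^+ 4 <= y ^+ 3 * (2 * n1 * T ^+ 2 * M + n2 * (q ^+ 2 + 3 * q - 1) * M ^+
    2) ->
  False.
Proof.
move=> q3 cE Q0 cQ n20 NE n10 n1le TE yN My M4.
have i2 : 0 < 2^-1 :> R by rewrite invr_gt0.
have q0 : 0 < q by lra.
have q1 : 0 < q - 1 by lra.
have N0 : 0 < N by rewrite NE mulr_gt0.
have c0 : 0 < c by rewrite cE divr_gt0 //; lra.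
have y0 : 0 < y.
  apply: lt_le_trans yN; rewrite mulr_gt0 // addr_gt0 // mulr_gt0 // invr_gt0
    //.
(* The constant 3 of the theorem enters here: [(q - 2) * (q + 3) >= q * (q - 1)] amounts to
   [q >= 3], with equality at 3. *)
have cy0 : 1 <= c * (1 + 3 * q^-1).
  have -> : c * (1 + 3 * q^-1) = (q - 2) * (q + 3) / (q * (q - 1)).
    by rewrite cE; field; rewrite !gt_eqF.
  rewrite ler_pdivlMr ?mulr_gt0 //; nra.
have cy : N <= c * y.
  apply: le_trans (ler_wpM2l (ltW c0) yN).
  by rewrite mulrA ler_peMl // ltW.
have cQ0 : 0 < c ^+ 2 * Q by rewrite mulr_gt0 // exprn_gt0.
have T0 : 0 <= T.
  by rewrite TE divr_ge0 // mulr_ge0 // ?exprn_ge0 // ltW.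
(* 41/60 is 41/40, from the bound on [n1], times 2/3, from the lower bound on [c ^+ 2 * Q]. *)
have Tle : T * (q - 1) <= 41%:R / 60%:R * N.
  rewrite TE mulrAC ler_pdivrMr ?mulr_gt0 //.
  apply: (@le_trans _ _ (q ^+ 2 * (41%:R / 40%:R * ((q - 1) * N)) * (q - 1))).
    by rewrite (ler_pM2r q1) ler_wpM2l // exprn_ge0 // ltW.
  have := ler_wpM2l (ltW N0) cQ; lra.
(* With [q - 1 >= 2] the constants multiply to [2 * (41/40) * (41/60) * (41/120)], slightly below
   1/2. *)
have a1 : 2 * n1 * T ^+ 2 <= N ^+ 3 / 2.
  have n1T : n1 * T <= 41%:R / 40%:R * (41%:R / 60%:R) * N ^+ 2.
    apply: (@le_trans _ _ (41%:R / 40%:R * ((q - 1) * N) * T)).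
      by rewrite ler_wpM2r.
    have := ler_wpM2l (ltW N0) Tle; lra.
  have T2 : T <= 41%:R / 120%:R * N.
    have : T * 2 <= T * (q - 1) by rewrite ler_wpM2l //; lra.
    lra.
  have h : n1 * T * T <= 41%:R / 40%:R * (41%:R / 60%:R) * N ^+ 2 * (41%:R /
    120%:R * N).
    by apply: ler_pM => //; rewrite mulr_ge0.
  have := exprn_gt0 3 N0; lra.
have a2 : n2 * (q ^+ 2 + 3 * q - 1) < c ^+ 2 * y / 2.
  apply: (@lt_le_trans _ _ (c ^+ 2 * ((1 + 3 * q^-1) * N) / 2)); last first.
    by rewrite (ler_pM2r i2) ler_wpM2l // exprn_ge0 // ltW.
  have -> : c ^+ 2 * ((1 + 3 * q^-1) * N) / 2
    = n2 * ((1 + 3 * q^-1) * (c ^+ 2 * Q) / 2).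
    by rewrite NE; ring.
  rewrite ltr_pM2l //.
  apply: (@lt_le_trans _ _ ((1 + 3 * q^-1) * ((q - 1) ^+ 2 * q ^+ 2 / 2) /
    2)); last first.
    by rewrite (ler_pM2r i2) ler_wpM2l // addr_ge0 // mulr_ge0 // invr_ge0 ltW.
  have -> : (1 + 3 * q^-1) * ((q - 1) ^+ 2 * q ^+ 2 / 2) / 2
     = (q - 1) ^+ 2 * (q ^+ 2 + 3 * q) / 4 by field; rewrite gt_eqF.
  have : 4 * (q ^+ 2 + 3 * q) <= (q - 1) ^+ 2 * (q ^+ 2 + 3 * q).
    by rewrite ler_wpM2r //; nra.
  lra.
have M0 : 0 < M by apply: lt_le_trans My; rewrite mulr_gt0 // exprn_gt0.
have y30 : 0 < y ^+ 3 by rewrite exprn_gt0.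
have cube : (c * y ^+ 2) ^+ 3 <= M ^+ 3.
  by rewrite lerXn2r ?nnegrE // ltW // mulr_gt0 // exprn_gt0.
have sq : (c * y ^+ 2) ^+ 2 <= M ^+ 2.
  by rewrite lerXn2r ?nnegrE // ltW // mulr_gt0 // exprn_gt0.
have b1 : y ^+ 3 * (2 * n1 * T ^+ 2) <= M ^+ 3 / 2.
  apply: (@le_trans _ _ (y ^+ 3 * ((c * y) ^+ 3 / 2))).
    rewrite (ler_pM2l y30) (le_trans a1) // (ler_pM2r i2).
    by rewrite lerXn2r ?nnegrE // ltW // mulr_gt0.
  have -> : y ^+ 3 * ((c * y) ^+ 3 / 2) = (c * y ^+ 2) ^+ 3 / 2 by ring.
  by rewrite (ler_pM2r i2).
have b2 : y ^+ 3 * (n2 * (q ^+ 2 + 3 * q - 1) * M) < M ^+ 3 / 2.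
  apply: (@lt_le_trans _ _ (y ^+ 3 * (c ^+ 2 * y / 2 * M))).
    by rewrite (ltr_pM2l y30) (ltr_pM2r M0).
  have -> : y ^+ 3 * (c ^+ 2 * y / 2 * M) = (c * y ^+ 2) ^+ 2 * (M / 2) by ring.
  have -> : M ^+ 3 / 2 = M ^+ 2 * (M / 2) by ring.
  by rewrite ler_pM2r // divr_gt0.
have : M ^+ 3 * M < M ^+ 3 * M.
  rewrite -{1}exprSr; apply: le_lt_trans M4 _.
  have -> : y ^+ 3 * (2 * n1 * T ^+ 2 * M + n2 * (q ^+ 2 + 3 * q - 1) * M ^+ 2)
    = (y ^+ 3 * (2 * n1 * T ^+ 2) + y ^+ 3 * (n2 * (q ^+ 2 + 3 * q - 1) * M))
      * M by ring.
  by rewrite ltr_pM2r //; lra.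
by rewrite ltxx.
Qed.

(** In the variable [s = t - 3] the difference of the two sides has only positive coefficients. *)
Lemma sextic_bound (R : realFieldType) (t : R) : 3 <= t ->
  (t - 1) ^+ 2 * t ^+ 2 / 2 * (t - 1) ^+ 2
    <= (t - 2) ^+ 2 * (t ^+ 4 + t ^+ 3 + t ^+ 2 + t + 1).
Proof.
rewrite -subr_ge0; move: (t - 3) (subrK 3 t) => s <- s0; rewrite -subr_ge0.
have -> : (s + 3 - 2) ^+ 2 * ((s + 3) ^+ 4 + (s + 3) ^+ 3 + (s + 3) ^+ 2 + (s
  + 3) + 1)
    - (s + 3 - 1) ^+ 2 * (s + 3) ^+ 2 / 2 * (s + 3 - 1) ^+ 2
  = (98%:R + 384%:R * s + 514%:R * s ^+ 2 + 318%:R * s ^+ 3 + 101%:R * s ^+ 4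
     + 16%:R * s ^+ 5 + s ^+ 6) / 2 by field.
by rewrite divr_ge0 // !addr_ge0 // ?mulr_ge0 ?exprn_ge0.
Qed.

(* 41/40 is the value of (b + 1) / (b - 1) at b = q^(k-1) = 3^4. *)
Lemma degree_ratio_bound (R : realFieldType) (q b x z : R) :
  3 <= q -> 81%:R <= b -> 0 <= z -> x * (q * b - q) = ((q * b) ^+ 2 - q) * z ->
  x <= 41%:R / 40%:R * ((q * b - 1) * z).
Proof.
move=> q3 b81 z0 E; have q0 : 0 < q by lra.
have d0 : 0 < q * b - q by rewrite subr_gt0 ltr_pMr //; lra.
have b0 : 0 < b by lra.
have qb : 0 <= q * (q * b - 1) by rewrite mulr_ge0 ?ltW //; nra.
rewrite -(ler_pM2r d0) E.
have -> : 41%:R / 40%:R * ((q * b - 1) * z) * (q * b - q)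
  = q * (q * b - 1) * (41%:R / 40%:R * (b - 1)) * z by ring.
apply: ler_wpM2r => //.
apply: (@le_trans _ _ (q * (q * b - 1) * (b + 1))).
  have : 0 <= q * b * (q - 1) by rewrite mulr_ge0 ?mulr_ge0 ?ltW //; lra.
  lra.
by apply: ler_wpM2l => //; lra.
Qed.

(** * Duality, and the moment bounds for an intersecting family *)

Section Assembly.
Variables (F : finFieldType) (k : nat).
Hypothesis k_gt4 : (4 < k)%N.
Local Notation V := 'rV[F]_(2 * k).
Local Notation q := (#|F|%:R : rat).
Local Notation nk := (nabove F (2 * k) k).
Local Notation qn := (qnum F).
Implicit Types (U W S H J p r s : {vspace V}) (Y : {set {vspace V}}).

Definition codegree Y H : rat := #|[pred U | (U \in Y) && (U <= H)%VS]|%:R.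

(** Two [k]-spaces of a [2k]-space meet nontrivially exactly when their sum is proper, and then
    [perp (U + W)] is a nonzero subspace of both complements. *)
Lemma intersecting_perp Y : intersecting Y -> intersecting [set perp U | U in
  Y].
Proof.
case=> dY iY; split.
  by move=> _ /imsetP[U UY ->]; rewrite dim_perp dY //; lia.
move=> _ _ /imsetP[U UY ->] /imsetP[W WY ->].
have : (perp (U + W) <= perp U :&: perp W)%VS.
  by rewrite subv_cap !sub_perp addvSl addvSr.
move=> /dimvS; apply: contraTneq => ->; rewrite dimv0 dim_perp.
have := dimv_sum_cap U W; rewrite (dY U) // (dY W) //.
have := iY _ _ UY WY; rewrite -dimv_eq0; lia.
Qed.

Lemma codegree_perp Y H : codegree Y H = degree [set perp U | U in Y] (perp H).
Proof.
rewrite /codegree /degree; congr (_%:R).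
rewrite -(card_imset _ (inv_inj (@perpK F (2 * k)))).
apply: eq_card => U; rewrite !inE; apply/imsetP/andP.
  by move=> [W /andP[WY WH] ->]; rewrite imset_f // sub_perp.
by move=> [/imsetP[W WY ->]]; rewrite sub_perp => WH; exists W;
  rewrite // inE WY.
Qed.

Lemma card_imset_perp Y : #|[set perp U | U in Y]| = #|Y|.
Proof. exact/card_imset/inv_inj/perpK. Qed.

Section Moments.
Variables (Y : {set {vspace V}}) (T : rat).
Hypothesis intY : intersecting Y.
Hypothesis degT : forall p, point p -> degree Y p <= T.
Hypothesis codegT : forall H, \dim H = (2 * k - 1)%N -> codegree Y H <= T.

Let y : rat := #|Y|%:R.
Let avg := qn k * y / qn (2 * k).
Let w p := degree Y p - avg.
Let M := \sum_(p | point p) w p ^+ 2.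
Let dimY U : U \in Y -> \dim U = k. Proof. by case: intY => h _; apply: h. Qed.

Let exchange (f : {vspace V} -> rat) :
  \sum_(p | point p) degree Y p * f p
    = \sum_(U in Y) \sum_(p | point p && (p <= U)%VS) f p.
Proof. by rewrite incidence_exchange. Qed.

Let sum_degree : \sum_(p | point p) degree Y p = y * qn k.
Proof.
transitivity (\sum_(p | point p) degree Y p * 1);
  first by apply: eq_bigr => p _; rewrite mulr1.
rewrite exchange mulr_natl -sumr_const; apply: eq_bigr => U UY.
by rewrite sumr_const card_points dimY.
Qed.

Let card_pt : #|[pred p : {vspace V} | point p]|%:R = qn (2 * k).
Proof.
have := card_points (fullv : {vspace V}); rewrite dimrv => <-.
by congr (_%:R); apply: eq_card => p; rewrite !inE subvf andbT.
Qed.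

Let qn_gt0 d : (0 < d)%N -> 0 < qn d.
Proof.
move=> d0; rewrite divr_gt0 ?qsub1_gt0 // subr_gt0.
by rewrite -(expr0 q) qX_lt.
Qed.

Let qn2k : 0 < qn (2 * k). Proof. by apply: qn_gt0; lia. Qed.

Let sum_const a : \sum_(p : {vspace V} | point p) a = qn (2 * k) * a.
Proof. by rewrite sumr_const -mulr_natl card_pt. Qed.

Let sum_w : \sum_(p | point p) w p = 0.
Proof. by rewrite sumrB sum_degree sum_const /avg; field; rewrite gt_eqF. Qed.

Let ME : M = \sum_(U in Y) wsum w U.
Proof.
rewrite -exchange; transitivity (\sum_(p | point p) (degree Y p * w p - avg *
  w p)).
  by apply: eq_bigr => p _; rewrite /w; ring.
by rewrite sumrB -mulr_sumr sum_w mulr0 subr0.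
Qed.

Let sum_degree2 : y ^+ 2 <= \sum_(p | point p) degree Y p ^+ 2.
Proof.
under eq_bigr do rewrite expr2;
  rewrite exchange expr2 {1}/y mulr_natl -sumr_const.
apply: ler_sum => U UY.
apply: (@le_trans _ _ (\sum_(S in Y) \sum_(r | (point r && (r
  <= U)%VS) && (r <= S)%VS) 1)).
  rewrite /y -sum1_card natr_sum; apply: ler_sum => S SY.
  have [r pr] := ex_point (intY.2 _ _ UY SY); rewrite subv_cap => /andP[rU rS].
  by rewrite (bigD1 r) /= ?pr ?rU ?rS // lerDl sumr_ge0.
rewrite (incidence_exchange (fun U r => (r
  <= U)%VS) [pred S | S \in Y] [pred r | point r && (r <= U)%VS]).
by apply: ler_sum => r _; rewrite mulr1.
Qed.

Let M_ge : (q - 2) / (q - 1) * y ^+ 2 <= M.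
Proof.
have -> : M = \sum_(p | point p) degree Y p ^+ 2 - qn k ^+ 2 / qn (2 * k) * y
  ^+ 2.
  transitivity (\sum_(p | point p) (degree Y p ^+ 2 - 2 * avg * degree Y p +
    avg ^+ 2)).
    by apply: eq_bigr => p _; rewrite /w; ring.
  rewrite big_split sumrB /= -mulr_sumr sum_degree sum_const /avg.
  by field; rewrite gt_eqF.
have q1 := qsub1_gt0 F.
(* By [sum_degree2] the uncentred sum is at least [y ^+ 2]; it remains to see that centring costs at
   most [y ^+ 2 / (q - 1)]. *)
suff h : qn k ^+ 2 / qn (2 * k) <= (q - 1)^-1.
  have := ler_wpM2r (sqr_ge0 y) h.
  have -> : (q - 2) / (q - 1) * y ^+ 2 = y ^+ 2 - (q - 1)^-1 * y ^+ 2.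
    by field; rewrite gt_eqF.
  by move: sum_degree2; lra.
rewrite ler_pdivrMr // /qnum mulnC exprM.
have x1 : 1 <= q ^+ k by rewrite exprn_ege1 // ltW ?q_gt1.
set x := q ^+ k in x1 *.
have -> : ((x - 1) / (q - 1)) ^+ 2 = (x - 1) ^+ 2 * ((q - 1) ^- 2).
  by rewrite expr_div_n.
have -> : (q - 1)^-1 * ((x ^+ 2 - 1) / (q - 1)) = (x ^+ 2 - 1) * ((q - 1) ^- 2).
  by field; rewrite gt_eqF.
by rewrite ler_wpM2r ?invr_ge0 ?sqr_ge0 //; nra.
Qed.

Let T_avg : avg <= T.
Proof.
rewrite -(ler_pM2l qn2k) -(sum_const T).
have -> : qn (2 * k) * avg = \sum_(p | point p) degree Y p.
  by rewrite sum_degree /avg; field; rewrite gt_eqF.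
by apply: ler_sum.
Qed.

Let avg_ge0 : 0 <= avg.
Proof.
apply: divr_ge0; last exact: ltW.
by apply: mulr_ge0; [apply/ltW/qn_gt0; lia | apply: ler0n].
Qed.

Let sqr_dev d : 0 <= d -> d <= T -> (d - avg) ^+ 2 <= T ^+ 2.
Proof. by move=> d0 dT; move: T_avg avg_ge0; nra. Qed.

(** A member outside [H] meets it in dimension [k - 1], and a member inside has [q ^+ (k - 1)] more
    points there. The constant parts combine with the mean to leave [- avg] in the same scale. *)
Let wsum_hyperplane H : \dim H = (2 * k - 1)%N ->
  wsum w H = q ^+ (k - 1) * (codegree Y H - avg).
Proof.
move=> dH; have q1 := qsub1_gt0 F.
have dimI U : U \in Y -> qn (\dim (U :&: H))
  = qn (k - 1) + q ^+ (k - 1) * (U <= H)%VS%:R.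
  move=> UY; have [UH|nUH] := boolP (U <= H)%VS.
    rewrite (capv_idPl UH) dimY //.
    rewrite /qnum (_ : q ^+ k = q * q ^+ (k - 1)); last by rewrite -exprS;
      congr (_ ^+ _); lia.
    by rewrite /= mulr1; field; rewrite gt_eqF.
  rewrite mulr0 addr0; congr (qn _).
  have := dimv_sum_cap U H; rewrite (dimY UY) dH.
  have : (\dim H < \dim (U + H))%N.
    rewrite (ltn_leqif (dimv_leqif_sup (addvSr U H))); apply: contra nUH.
    by rewrite subv_add => /andP[].
  have := dim_le_n (U + H); rewrite dH; lia.
have e1 : \sum_(p | point p && (p <= H)%VS) degree Y p
    = y * qn (k - 1) + q ^+ (k - 1) * codegree Y H.
  transitivity (\sum_(p | point p && (p <= H)%VS) degree Y p * 1);
    first by apply: eq_bigr => p _; rewrite mulr1.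
  rewrite -(incidence_exchange (fun U p => (p
    <= U)%VS) [pred U | U \in Y] [pred p | point p && (p <= H)%VS]).
  transitivity (\sum_(U in Y) (qn (k - 1) + q ^+ (k - 1) * (U <= H)%VS%:R)).
    apply: eq_bigr => U UY; rewrite sumr_const -dimI // -card_points;
      congr (_%:R).
    by apply: eq_card => p; rewrite ![in LHS]unfold_in [RHS]unfold_in /=
      subv_cap -andbA [X in _ && X]andbC.
  rewrite big_split /=; congr (_ + _);
    first by rewrite sumr_const -[LHS]mulr_natl.
  rewrite -mulr_sumr -natr_sum; congr (_ * _%:R).
  by rewrite -sum1_card big_mkcondr; apply: eq_bigr => U _; case: (U <= H)%VS.
have e2 : \sum_(p | point p && (p <= H)%VS) avg = qn (2 * k - 1) * avg.
  by rewrite sumr_const -[LHS]mulr_natl (card_points H) dH.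
rewrite /wsum sumrB e1 e2 /avg.
move: qn2k; rewrite /qnum.
have -> : (2 * k = (k - 1) + (k - 1) + 2)%N by lia.
have -> : (k - 1 + (k - 1) + 2 - 1 = (k - 1) + (k - 1) + 1)%N by lia.
have -> : q ^+ k = q ^+ (k - 1) * q by rewrite -exprSr; congr (_ ^+ _); lia.
rewrite !exprD expr1; set x := q ^+ (k - 1) => pos.
have nz : x * x * q ^+ 2 - 1 != 0.
  by apply: contraTneq pos => ->; rewrite mul0r ltxx.
by field; rewrite nz gt_eqF.
Qed.

(** [M] is also the sum of [wsum w] over [Y] ([ME]). The power mean inequality over [Y] brings in
    fourth powers, and the sum is then enlarged to all [k]-spaces. *)
Lemma fourth_moment_family : exists2 M : rat, (q - 2) / (q - 1) * y ^+ 2 <= M &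
  M ^+ 4 <= y ^+ 3 * (2 * nk 1 * T ^+ 2 * M + nk 2 * (q ^+ 2 + 3 * q - 1) * M
    ^+ 2).
Proof.
exists M => //.
rewrite {1}ME; apply: le_trans (pow4_sum_le _ _) _.
rewrite ler_wpM2l ?exprn_ge0 //.
apply: (@le_trans _ _ (\sum_(U | \dim U == k) wsum w U ^+ 4)).
  rewrite [leRHS](bigID [pred U | U \in Y]) /=.
  rewrite [X in _ <= X + _](eq_bigl [pred U | U \in Y]); last first.
    by move=> U; rewrite /= andbC; case UY: (U \in Y); rewrite //= dimY ?eqxx.
  by rewrite lerDl sumr_ge0 // => U _; rewrite exprn_even_ge0.
apply: fourth_moment => //.
  by move=> p pp; apply: sqr_dev; [apply: ler0n | apply: degT].
move=> H dH; rewrite wsum_hyperplane // !exprMn ler_wpM2l ?sqr_ge0 //.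
by apply: sqr_dev; [apply: ler0n | apply: codegT].
Qed.

End Moments.

(** By [degree_le] at least [3 * q^-1 * (qn k * nk 2)] members miss [p]; [cross_bound] then limits
    the number through [p]. *)
Lemma degree_bound Y p : 3 <= q -> intersecting Y ->
  (forall p, point p -> exists2 S, S \in Y & ~~ (p <= S)%VS) ->
  (1 + 3 * q^-1) * (qn k * nk 2) <= #|Y|%:R -> point p ->
  degree Y p <= q ^+ 2 * nk 1 / (3 * (((q - 2) / (q - 1)) ^+ 2 * qn k)).
Proof.
move=> q3 intY nd yN pp.
have dN := degree_le k_gt4 intY pp (nd _ pp).
have cb := cross_bound k_gt4 intY pp.
have q0 : 0 < q by lra.
have n20 : 0 < nk 2 by rewrite nabove_gt0 //; lia.
have Q0 : 0 < qn k.
  by rewrite divr_gt0 ?qsub1_gt0 // subr_gt0 -(expr0 q) qX_lt //; lia.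
have c0 : 0 < (q - 2) / (q - 1) by rewrite divr_gt0 ?qsub1_gt0 //; lra.
set c := (q - 2) / (q - 1) in cb c0 *.
have cQ0 : 0 < c ^+ 2 * qn k by rewrite mulr_gt0 // exprn_gt0.
rewrite ler_pdivlMr; last by rewrite mulr_gt0.
have D0 : 0 <= degree Y p by apply: ler0n.
have B0 : 3 * q^-1 * (qn k * nk 2) <= #|Y|%:R - degree Y p by lra.
have h : c ^+ 2 * (degree Y p * (3 * q^-1 * (qn k * nk 2))) <= q * nk 1 * nk 2.
  by apply: le_trans cb; rewrite ler_wpM2l ?ler_wpM2l // exprn_ge0 // ltW.
have qn2 : 0 < q^-1 * nk 2 by rewrite mulr_gt0 ?invr_gt0.
rewrite -(ler_pM2r qn2).
have -> : q ^+ 2 * nk 1 * (q^-1 * nk 2) = q * nk 1 * nk 2 by field;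
  rewrite gt_eqF.
by apply: le_trans h; lra.
Qed.

Lemma nk1_le : 3 <= q -> nk 1 <= 41%:R / 40%:R * ((q - 1) * (qn k * nk 2)).
Proof.
move=> q3; have q1 := qsub1_gt0 F.
have -> : (q - 1) * (qn k * nk 2) = (q ^+ k - 1) * nk 2.
  by rewrite /qnum; field; rewrite gt_eqF.
have n20 : 0 <= nk 2 by apply: nk_ge0.
have kE : (k = (k - 1).+1)%N by lia.
have := @naboveS F (2 * k) k 1; move=> /(_ ltac:(lia)).
have -> : q ^+ (2 * k) = (q ^+ k) ^+ 2 by rewrite mulnC exprM.
have -> : q ^+ k = q * q ^+ (k - 1) by rewrite {1}kE exprS.
have b81 : 81%:R <= q ^+ (k - 1).
  apply: (@le_trans _ _ (q ^+ 4)); last by apply: qX_le; lia.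
  have -> : 81%:R = 3 ^+ 4 :> rat by rewrite -natrX.
  by rewrite lerXn2r ?nnegrE //; lra.
set b := q ^+ (k - 1) in b81 *; set x := nk 1; set z := nk 2 in n20 *.
by rewrite expr1; apply: degree_ratio_bound.
Qed.

(** The right side grows with [k], so [k = 5] suffices; clearing denominators there leaves
    [sextic_bound]. *)
Lemma qnum_lower : 3 <= q ->
  (q - 1) ^+ 2 * q ^+ 2 / 2 <= ((q - 2) / (q - 1)) ^+ 2 * qn k.
Proof.
move=> q3; have q1 := qsub1_gt0 F.
have h5 : q ^+ 5 <= q ^+ k by apply: qX_le.
apply: (@le_trans _ _ (((q - 2) / (q - 1)) ^+ 2 * qn 5)); last first.
  by rewrite ler_wpM2l ?sqr_ge0 // ler_pM2r ?invr_gt0 // lerB.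
have -> : ((q - 2) / (q - 1)) ^+ 2 * qn 5
   = (q - 2) ^+ 2 * (q ^+ 4 + q ^+ 3 + q ^+ 2 + q + 1) / (q - 1) ^+ 2.
  by rewrite /qnum; field; rewrite gt_eqF.
rewrite ler_pdivlMr ?exprn_gt0 //.
exact: sextic_bound.
Qed.

End Assembly.

(** * Gaussian binomials and the final bound *)

Lemma gauss_binom1 (F : finFieldType) k : gauss_binom #|F| k 1 = qnum F k.
Proof. by rewrite /gauss_binom big_nat1 subn1. Qed.

Lemma nabove_gauss_binom (F : finFieldType) k : (4 < k)%N ->
  nabove F (2 * k) k 2 = gauss_binom #|F| (2 * k - 2) (k - 2).
Proof.
move=> k4; set q := #|F|%:R : rat.
have q0 : q != 0 by rewrite gt_eqF ?q_gt0.
have E m i : (i <= m)%N -> q ^+ m - q ^+ i = q ^+ i * (q ^+ (m - i) - 1).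
  by move=> im; rewrite mulrBr mulr1 -exprD subnKC.
rewrite /nabove /gauss_binom -/q.
(* Cancel [q ^+ i] in each factor. The numerators then match after a shift of the index, the
   denominators after a reversal. *)
transitivity (\prod_(2 <= i < k) ((q ^+ (2 * k - i) - 1) / (q ^+ (k - i) - 1))).
  rewrite !big_nat; apply: eq_bigr => i /andP[_ ik].
  rewrite (E _ _ (ltnW ik)) E; last by lia.
  by rewrite -mulf_div divff ?mul1r // expf_neq0.
rewrite !big_split /= !prodfV; congr (_ / _).
  rewrite big_add1 (_ : k.-1 = (k - 2).+1); last by lia.
  by rewrite !big_nat; apply: eq_bigr => i /andP[i0 _]; congr (_ ^+ _ - 1); lia.
rewrite big_add1 (_ : k.-1 = (k - 2).+1); last by lia.
rewrite [RHS]big_nat_rev /= !big_nat; apply: eq_bigr => i /andP[i0 ik].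
by congr (_ ^+ _ - 1); lia.
Qed.

(** Applying [degree_bound] to [Y] and to its family of complements bounds degrees and codegrees by
    the same [T], as [fourth_moment_family] requires; [moment_contradiction] concludes. *)
Lemma intersecting_bound (F : finFieldType) (k : nat) (Y : {set {vspace
  'rV[F]_(2 * k)}}) :
  (4 < k)%N -> (3 <= #|F|)%N -> intersecting Y ->
  (forall p, point p -> exists2 S, S \in Y & ~~ (p <= S)%VS) ->
  (forall H, \dim H = (2 * k - 1)%N -> exists2 S, S \in Y & ~~ (S <= H)%VS) ->
  #|Y|%:R < (1 + 3 * #|F|%:R^-1) * (qnum F k * nabove F (2 * k) k 2).
Proof.
move=> k4 q3n intY nd ndd; rewrite ltNge; apply/negP => yN.
have q3 : 3 <= #|F|%:R :> rat by rewrite ler_nat.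
have degT := degree_bound k4 q3 intY nd yN.
have Qk0 : 0 < qnum F k.
  by rewrite divr_gt0 ?qsub1_gt0 // subr_gt0 -(expr0 #|F|%:R) qX_lt //; lia.
have codegT H : \dim H = (2 * k - 1)%N -> codegree Y H
    <= #|F|%:R ^+ 2 * nabove F (2 * k) k 1
       / (3 * (((#|F|%:R - 2) / (#|F|%:R - 1)) ^+ 2 * qnum F k)).
  move=> dH; rewrite codegree_perp; apply: degree_bound => //.
  - exact: intersecting_perp.
  - move=> p /eqP dp; have dpp : \dim (perp p) = (2 * k - 1)%N
    by rewrite dim_perp dp.
    have [S SY nle] := ndd _ dpp; exists (perp S); first exact: imset_f.
    by rewrite -[p]perpK sub_perp.
  - by rewrite card_imset_perp.
  - by rewrite /point dim_perp dH; lia.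
have [M My M4] := fourth_moment_family k4 intY degT codegT.
apply: (moment_contradiction q3 erefl Qk0 (qnum_lower k4 q3) _ erefl _
  (nk1_le k4 q3) erefl yN My M4).
  by rewrite nabove_gt0 //; lia.
exact: nk_ge0.
Qed.

Theorem theorem5 (F : finFieldType) (q k : nat)
    (card_F : #|F| = q) (q_ge3 : (3 <= q)%N) (k_ge5 : (5 <= k)%N)
    (Y : {set qkneser_vertex F k})
    (indepY : independent (@qkneser_adj F k) Y)
    (not_dictator : ~ exists P : {vspace 'rV[F]_(2 * k)},
        \dim P = 1%N /\ Y \subset dictator P)
    (not_dual : ~ exists H : {vspace 'rV[F]_(2 * k)},
        \dim H = (2 * k - 1)%N /\ Y \subset dual_dictator H) :
  #|Y|%:R < (1 + 3 * q%:R^-1) * gauss_binom q k 1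
             * gauss_binom q (2 * k - 2) (k - 2) :> rat.
Proof.
rewrite -card_F in q_ge3 *.
rewrite -mulrA gauss_binom1 -nabove_gauss_binom // -(card_imset _ val_inj).
apply: intersecting_bound => //.
- split=> [_ /imsetP[U _ ->]|_ _ /imsetP[U UY ->] /imsetP[W WY ->]].
    by apply/eqP; apply: (valP U).
  exact: (indepY _ _ UY WY).
- move=> p /eqP pp; have : ~~ (Y \subset dictator p).
    by apply/negP => sub; apply: not_dictator; exists p.
  by case/subsetPn => U UY; rewrite inE => nle; exists (val U);
    first exact: imset_f.
- move=> H dH; have : ~~ (Y \subset dual_dictator H).
    by apply/negP => sub; apply: not_dual; exists H.
  by case/subsetPn => U UY; rewrite inE => nle; exists (val U);
    first exact: imset_f.
Qed.
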